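(* Let $\Lambda$ be a semiprimary ring with quasi-uniform Loewy length (from the left). Then $\mathsf{Fin.dim}\,\Lambda$ is finite. If $\Lambda$ is in particular an Artin algebra (with quasi-uniform Loewy length), then $\mathsf{Fin.dim}\,\Lambda\le \mathsf{fin.dim}\,\Lambda^{\mathrm{op}}$.
   Context: Rings are associative with unit and modules are left modules unless stated otherwise. A ring $\Lambda$ is semiprimary if $\Lambda/J(\Lambda)$ is semisimple and the Jacobson radical $J(\Lambda)$ is nilpotent. The Loewy length of a $\Lambda$-module $M$ is the least $t\ge 0$ with $J(\Lambda)^tM=0$; the Loewy length of $\Lambda$ is that of the regular module. The Loewy length of a module is called maximal if it equals the Loewy length of $\Lambda$. $\Lambda$ has quasi-uniform Loewy length (from the left) if every indecomposable projective $\Lambda$-module whose top (the module modulo its radical) has infinite injective dimension has maximal Loewy length. $\mathsf{Fin.dim}\,R$ is the supremum of the projective dimensions of all left $R$-modules of finite projective dimension, and $\mathsf{fin.dim}\,R$ is the same supremum over finitely generated left $R$-modules of finite projective dimension; thus $\mathsf{fin.dim}\,\Lambda^{\mathrm{op}}$ concerns right $\Lambda$-modules. *)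

(* Defs.v *)
(* MathComp, with classical reasoning from mathcomp.classical.boolp.

   A ring is a [pzRingType] (associative, with unit, zero ring allowed), a left
   R-module is an [lmodType R], and right R-modules are left modules over the
   converse ring [R^c].  A submodule is a [{pred M}] satisfying the library's
   [submod_closed]; left ideals of R are submodules of the regular module
   [R^o].  Boolean predicates lose no generality, since [`[< _ >]] turns any
   Prop into a bool. *)
From HB Require Import structures.
From mathcomp Require Import all_boot all_order all_algebra ring_quotient.
From mathcomp Require Import boolp.

Set Implicit Arguments.
Unset Strict Implicit.
Unset Printing Implicit Defensive.

Import GRing.Theory.
Local Open Scope quotient_scope.
Local Open Scope ring_scope.

(* Extended natural numbers; [None] is infinity. *)
Definition enat := option nat.

Definition enat_le (a b : enat) : bool :=
  match a, b with
  | _, None => true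
  | None, Some _ => false
  | Some m, Some n => (m <= n)%N
  end.

(* The least n satisfying P, infinity if there is none. *)
Definition enat_least (P : nat -> Prop) : enat :=
  if pselect (exists n, `[< P n >]) is left exP then Some (ex_minn exP)
  else None.

(* The least upper bound; the supremum of the empty set is 0. *)
Definition enat_sup (E : enat -> Prop) : enat :=
  enat_least (fun n => forall a, E a -> enat_le a (Some n)).

Definition surjective (A B : Type) (f : A -> B) := forall y, exists x, f x = y.

Section Submodules.
Variables (R : pzRingType) (M : lmodType R).

Definition zero_module := forall x : M, x = 0.

Definition finitely_generated :=
  exists n (g : 'I_n -> M), forall x, exists a : 'I_n -> R,
    x = \sum_i a i *: g i.

(* M is the internal direct sum of N and N'. *)
Definition complementary (N N' : {pred M}) :=
  (forall x, x \in N -> x \in N' -> x = 0) /\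
  (forall x, exists y z, [/\ y \in N, z \in N' & x = y + z]).

Definition semisimple_module :=
  forall N : {pred M}, submod_closed N ->
    exists2 N' : {pred M}, submod_closed N' & complementary N N'.

Definition indecomposable :=
  ~ zero_module /\
  forall N N' : {pred M}, submod_closed N -> submod_closed N' ->
    complementary N N' ->
    (forall x, x \in N -> x = 0) \/ (forall x, x \in N' -> x = 0).

Definition maximal_submodule (N : {pred M}) :=
  [/\ submod_closed N, exists x, x \notin N &
      forall N' : {pred M}, submod_closed N' -> {subset N <= N'} ->
        {subset N' <= N} \/ (forall x, x \in N')].

(* The intersection of the maximal submodules, so M itself if there are none. *)
Definition radical : {pred M} :=
  fun x => `[< forall N : {pred M}, maximal_submodule N -> x \in N >].

Lemma radicalP x :
  reflect (forall N : {pred M}, maximal_submodule N -> x \in N) (x \in radical).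
Proof. exact: asboolP. Qed.

Lemma radical_submod_closed : submod_closed radical.
Proof.
split=> [|a u v /radicalP Ju /radicalP Jv]; apply/radicalP => N maxN.
  by case: maxN => -[].
by have [[_ linN] _ _] := maxN; apply: linN; [apply: Ju | apply: Jv].
Qed.

HB.instance Definition _ := GRing.isSubmodClosed.Build R M radical
  (GRing.submod_closed_semi radical_submod_closed).

(* The submodule of finite sums of products a *: x with a in I, x in N. *)
Definition ideal_smul (I : {pred R}) (N : {pred M}) : {pred M} :=
  fun y => `[< exists n (a : 'I_n -> R) (x : 'I_n -> M),
    [/\ forall i, a i \in I, forall i, x i \in N & y = \sum_i a i *: x i] >].

End Submodules.

Arguments radical {R} M.

(* The library provides the additive group structure of M / I.  The submodule
   is passed as a predicate with a proof, which [submodule_of] repackages as the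
   canonical instance the library expects. *)
Section QuotientModule.
Variables (R : pzRingType) (M : lmodType R).
Variables (I : {pred M}) (clI : submod_closed I).

Definition submodule_of of submod_closed I : {pred M} := I.
Local Notation J := (submodule_of clI).

HB.instance Definition _ := GRing.isSubmodClosed.Build R M J
  (GRing.submod_closed_semi clI).

Definition quotient_module : Type := {ideal_quot J}.
Local Notation Q := quotient_module.

HB.instance Definition _ := GRing.Zmodule.on Q.

Implicit Types (a b : R) (x y : Q).

Let cl (u : M) : Q := \pi_{ideal_quot J} u.

Let cl_surj x : {u | x = cl u}.
Proof. by exists (repr x); rewrite /cl reprK. Qed.

Definition quot_scale a x : Q := cl (a *: repr x).

Lemma quot_scaleE a (u : M) : quot_scale a (cl u) = cl (a *: u).
Proof.
apply/eqP; rewrite -Quotient.idealrBE -scalerBr rpredZ //.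
by rewrite Quotient.idealrBE reprK.
Qed.

Lemma quot_clD (u v : M) : cl u + cl v = cl (u + v).
Proof. by rewrite /cl Quotient.pi_add. Qed.

Lemma quot_scaleA a b x : quot_scale a (quot_scale b x) = quot_scale (a * b) x.
Proof. by have [u ->] := cl_surj x; rewrite !quot_scaleE scalerA. Qed.

Lemma quot_scale1 : left_id 1 quot_scale.
Proof. by move=> x; have [u ->] := cl_surj x; rewrite quot_scaleE scale1r. Qed.

Lemma quot_scaleDr : right_distributive quot_scale +%R.
Proof.
move=> a x y; have [[u ->] [v ->]] := (cl_surj x, cl_surj y).
by rewrite quot_clD !quot_scaleE quot_clD scalerDr.
Qed.

Lemma quot_scaleDl x : {morph quot_scale^~ x : a b / a + b}.
Proof.
by move=> a b; have [u ->] := cl_surj x; rewrite !quot_scaleE quot_clD scalerDl.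
Qed.

HB.instance Definition _ := GRing.Zmodule_isLmodule.Build R Q
  quot_scaleA quot_scale1 quot_scaleDr quot_scaleDl.

End QuotientModule.

Definition top (R : pzRingType) (M : lmodType R) : lmodType R :=
  quotient_module (radical_submod_closed M).

Section Jacobson.
Variable R : pzRingType.

Definition jacobson : {pred R} := radical R^o.

Lemma jacobson_mulr (x r : R) : x \in jacobson -> x * r \in jacobson.
Proof.
move=> /radicalP Jx; apply/radicalP => L maxL.
have [[L0 linL] _ maxL'] := maxL.
have LD u v : u \in L -> v \in L -> u + v \in L.
  by move=> Lu Lv; rewrite -[u]scale1r; apply: linL.
have LZ a u : u \in L -> a * u \in L.
  by move=> Lu; rewrite -[a * u]addr0; apply: (linL a u 0).
have [Lr | nLr] := boolP (r \in L); first exact: LZ.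
pose K : {pred R^o} := fun y => (y : R) * r \in L.
suff: x \in K by [].
apply: Jx; split.
- split=> [|a u v Ku Kv]; first by rewrite unfold_in /K mul0r.
  by rewrite unfold_in /K mulrDl -mulrA; apply: LD => //; apply: LZ.
- by exists 1; rewrite unfold_in /K mul1r.
move=> N [N0 linN] sKN.
have [sNK | /existsNP[y /not_implyP[Ny /negP nKy]]] := pselect {subset N <= K}.
  by left.
right=> z.
pose L' : {pred R^o} :=
  fun w => `[< exists a l, l \in L /\ w = a * (y * r) + l :> R >].
have L'P w : reflect (exists a l, l \in L /\ w = a * (y * r) + l :> R) (w \in L').
  exact: asboolP.
have clL' : submod_closed L'.
  split=> [|b u v /L'P[a [l [Ll ->]]] /L'P[a' [l' [Ll' ->]]]]; apply/L'P.
    by exists 0, 0; rewrite mul0r addr0.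
  exists (b * a + a'), (b * l + l'); split; first by apply: LD => //; apply: LZ.
  by rewrite /GRing.scale /= mulrDr mulrDl !mulrA addrACA.
have sLL' : {subset L <= L'}.
  by move=> l Ll; apply/L'P; exists 0, l; rewrite mul0r add0r.
case: (maxL' _ clL' sLL') => [sL'L | allL'].
  case/negP: nKy; rewrite unfold_in /K; apply: sL'L; apply/L'P.
  by exists 1, 0; rewrite mul1r addr0.
have /L'P[a [l [Ll zrE]]] := allL' (z * r).
have -> : z = a *: (y : R^o) + (z - a * y) by rewrite addrC subrK.
apply: linN => //; apply: sKN.
by rewrite unfold_in /K mulrBl zrE -mulrA addrC addKr.
Qed.

Definition residue_ring : Type := {ideal_quot (radical R^o)}.

HB.instance Definition _ := GRing.Zmodule.on residue_ring.

Implicit Types x y z : residue_ring.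

Let cl (u : R) : residue_ring := \pi_{ideal_quot (radical R^o)} u.

Definition residue_mul x y : residue_ring :=
  cl ((repr x : R) * (repr y : R)).

Let clE (u v : R) : (cl u == cl v) = (u - v \in jacobson).
Proof. exact: esym (@Quotient.idealrBE _ (radical R^o) u v). Qed.

Let clD (u v : R) : cl u + cl v = cl (u + v).
Proof. by rewrite /cl Quotient.pi_add. Qed.

Let cl_surj x : {u | x = cl u}.
Proof. by exists (repr x); rewrite /cl reprK. Qed.

Let jacobsonD (u v : R) :
  u \in jacobson -> v \in jacobson -> u + v \in jacobson.
Proof. exact: (@rpredD _ (radical R^o)). Qed.

Let jacobson_mull (u v : R) : v \in jacobson -> u * v \in jacobson.
Proof. exact: (@rpredZ _ _ (radical R^o) u v). Qed.

Lemma residue_mulE (u v : R) : residue_mul (cl u) (cl v) = cl (u * v).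
Proof.
have rE w : (repr (cl w) : R) - w \in jacobson by rewrite -clE /cl reprK.
apply/eqP; rewrite clE.
have -> : (repr (cl u) : R) * (repr (cl v) : R) - u * v =
          ((repr (cl u) : R) - u) * (repr (cl v) : R) +
          u * ((repr (cl v) : R) - v).
  by rewrite mulrBl mulrBr addrA subrK.
by apply: jacobsonD; [apply: jacobson_mulr | apply: jacobson_mull].
Qed.

Lemma residue_mulA : associative residue_mul.
Proof.
move=> x y z.
have [[[u ->] [v ->]] [w ->]] := (cl_surj x, cl_surj y, cl_surj z).
by rewrite !residue_mulE mulrA.
Qed.

Lemma residue_mul1 : left_id (cl 1) residue_mul.
Proof. by move=> x; have [u ->] := cl_surj x; rewrite residue_mulE mul1r. Qed.

Lemma residue_mulr1 : right_id (cl 1) residue_mul.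
Proof. by move=> x; have [u ->] := cl_surj x; rewrite residue_mulE mulr1. Qed.

Lemma residue_mulDl : left_distributive residue_mul +%R.
Proof.
move=> x y z.
have [[[u ->] [v ->]] [w ->]] := (cl_surj x, cl_surj y, cl_surj z).
by rewrite !residue_mulE !clD residue_mulE mulrDl.
Qed.

Lemma residue_mulDr : right_distributive residue_mul +%R.
Proof.
move=> x y z.
have [[[u ->] [v ->]] [w ->]] := (cl_surj x, cl_surj y, cl_surj z).
by rewrite !residue_mulE !clD residue_mulE mulrDr.
Qed.

HB.instance Definition _ := GRing.Zmodule_isPzRing.Build residue_ring
  residue_mulA residue_mul1 residue_mulr1 residue_mulDl residue_mulDr.

End Jacobson.

Arguments jacobson R : clear implicits.

Section LoewyLength.
Variable R : pzRingType.

(* The t-th power of the Jacobson radical, the 0-th one being R. *)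
Definition jacobson_exp (t : nat) : {pred R} :=
  iter t (@ideal_smul R R^o (jacobson R)) predT.

Definition semiprimary :=
  semisimple_module (residue_ring R)^o /\
  exists t, forall x, x \in jacobson_exp t -> x = 0.

Definition loewy_length (M : lmodType R) : enat :=
  enat_least (fun t => forall x, x \in @ideal_smul R M (jacobson_exp t) predT ->
    x = 0).

Definition maximal_loewy_length (M : lmodType R) :=
  loewy_length M = loewy_length R^o.

End LoewyLength.

Section HomologicalDimension.
Variable R : pzRingType.
Implicit Types M P E A B C : lmodType R.

Definition projective P :=
  forall A B (g : {linear A -> B}) (f : {linear P -> B}), surjective g ->
    exists h : {linear P -> A}, forall x, g (h x) = f x.

Definition injective_module E :=
  forall A B (g : {linear A -> B}) (f : {linear A -> E}), injective g ->
    exists h : {linear B -> E}, forall x, h (g x) = f x.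

Definition exact_at A B C (f : A -> B) (g : B -> C) :=
  forall y, g y = 0 <-> exists x, f x = y.

(* 0 -> P n -> ... -> P 1 -> P 0 -> M -> 0 *)
Definition has_proj_resolution M (n : nat) :=
  exists (P : nat -> lmodType R) (d : forall i, {linear P i.+1 -> P i})
         (e : {linear P 0%N -> M}),
    [/\ forall i, projective (P i),
        forall i, (n < i)%N -> zero_module (P i),
        surjective e,
        exact_at (d 0%N) e
      & forall i, exact_at (d i.+1) (d i)].

(* 0 -> M -> E 0 -> E 1 -> ... -> E n -> 0 *)
Definition has_inj_resolution M (n : nat) :=
  exists (E : nat -> lmodType R) (d : forall i, {linear E i -> E i.+1})
         (e : {linear M -> E 0%N}),
    [/\ forall i, injective_module (E i),
        forall i, (n < i)%N -> zero_module (E i),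
        injective e,
        exact_at e (d 0%N)
      & forall i, exact_at (d i) (d i.+1)].

Definition proj_dim M : enat := enat_least (has_proj_resolution M).
Definition inj_dim M : enat := enat_least (has_inj_resolution M).

Definition Findim : enat :=
  enat_sup (fun a => exists M, proj_dim M <> None /\ a = proj_dim M).

Definition findim : enat :=
  enat_sup (fun a => exists M,
    [/\ finitely_generated M, proj_dim M <> None & a = proj_dim M]).

Definition quasi_uniform_loewy_length :=
  forall P, projective P -> indecomposable P -> inj_dim (top P) = None ->
    maximal_loewy_length P.

End HomologicalDimension.

Definition artinian (k : comPzRingType) :=
  forall I : nat -> {pred k^o}, (forall n, submod_closed (I n)) ->
    (forall n, {subset I n.+1 <= I n}) ->
    exists n, forall m, (n <= m)%N -> I m =i I n.

(* R is an algebra, finitely generated as a module, over a commutative artinian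
   ring k acting through phi. *)
Definition artin_algebra (R : pzRingType) :=
  exists (k : comPzRingType) (phi : {rmorphism k -> R}),
    [/\ artinian k,
        forall a x, phi a * x = x * phi a
      & exists n (g : 'I_n -> R), forall x, exists a : 'I_n -> k,
          x = \sum_i phi (a i) * g i].

(* Main.v *)
Require Import Defs.
From HB Require Import structures.
From mathcomp Require Import all_boot all_order all_algebra.
From mathcomp Require Import ring_quotient boolp classical_sets functions.

(** Let J be the Jacobson radical of R. An idempotent e with Re/Je simple
    defines two simple modules: S = Re/Je on the left and T = eR/eJ on the
    right. Their homological behaviour is linked: if P is the k-th term of a
    minimal projective resolution of a left module M, then Ext^k(M, S) =
    Hom(P, S) and Tor_k(T, M) = T (x) P vanish together, namely when e P is
    contained in J P.

    First consequence ([dual_top_finite_proj_dim]): if S has finite injective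
    dimension m, then Ext^(m+1)(R/J, S) = 0, so Tor_(m+1)(T, R/J) = 0, and
    this bounds the projective dimension of T by m because right modules over
    R have projective covers as well ([semiprimary_converse]).

    Second consequence ([proj_dim_lower_bound]): if M has projective dimension
    d > 0 and the last term P of its minimal resolution satisfies e P <> e J
    P, then Tor_d(T, M) <> 0 and the projective dimension of T is at least d.

    Quasi-uniform Loewy length provides such an e for which both apply
    ([non_maximal_principal]). Let n be the Loewy length of R. Minimality puts
    P inside J Q, where Q is the preceding term, so J^(n-1) P = 0. For any e
    with e P <> e J P the module Re is an image of the projective P, so
    J^(n-1) Re = 0 and Re does not have maximal Loewy length; hence its top S
    has finite injective dimension, T has finite projective dimension, and
    that dimension is at least d. Finitely many e suffice
    ([local_idempotents_span]), which bounds d; and each T is cyclic, which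
    compares d with the finitistic dimension of the finitely generated right
    modules.

    Two devices replace standard machinery. Tensor products are avoided by the
    duality M |-> Hom_Z(M, Q/Z), which turns projective resolutions of left
    modules into injective resolutions of right modules ([dual_injective]);
    Ext(T, Hom_Z(M, Q/Z)) is the dual of Tor(T, M), and the vanishing of Ext
    moves between the two arguments by dimension shifting ([staircase]).
    Minimal resolutions are avoided by measuring, for L inside a projective Q,
    the defect of a retraction of Q onto L modulo J
    ([approximate_retraction]): a defect that maps L into JL is nilpotent, and
    then L is a direct summand ([split_of_small_defect]). *)

Set Implicit Arguments.
Unset Strict Implicit.
Unset Printing Implicit Defensive.

Import Order.TTheory GRing.Theory Num.Theory.
Local Open Scope quotient_scope.
Local Open Scope ring_scope.

(** * Submodules and quotients as modules *)

Section Constructions.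
Variable R : pzRingType.
Implicit Types A B C M N P Q : lmodType R.

Lemma linear_exists M N (f : M -> N) :
  linear f -> exists g : {linear M -> N}, g =1 f.
Proof.
move=> lin_f.
pose g := GRing.isLinear.Build R M N *:%R f lin_f.
by exists (HB.pack_for {linear M -> N} f g).
Qed.

Section Submodule.
Variables (M : lmodType R) (I : {pred M}) (clI : submod_closed I).

Local Notation J := (submodule_of clI).

Definition sub_module : Type := {x : M | x \in J}.
HB.instance Definition _ := SubType.on sub_module.
HB.instance Definition _ := Choice.on sub_module.
HB.instance Definition _ := [SubChoice_isSubLmodule of sub_module by <:].

Definition sub_incl : {linear sub_module -> M} := val.

Lemma sub_incl_inj : injective sub_incl.
Proof. exact: val_inj. Qed.

Lemma sub_inclP x : sub_incl x \in I.
Proof. exact: (valP x). Qed.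

Lemma sub_incl_lift x : x \in I -> exists y, sub_incl y = x.
Proof. by move=> Ix; exists (Sub x Ix : sub_module); apply: SubK. Qed.

Definition quot_pi (x : M) : quotient_module clI := \pi_{ideal_quot J} x.

Lemma quot_pi_linear : linear quot_pi.
Proof.
move=> a x y; rewrite -[a *: quot_pi x]/(quot_scale a (\pi_{ideal_quot J} x)).
by rewrite quot_scaleE quot_clD.
Qed.
HB.instance Definition _ :=
  GRing.isLinear.Build R M (quotient_module clI) *:%R quot_pi quot_pi_linear.

Definition quot_map : {linear M -> quotient_module clI} := quot_pi.

Lemma quot_map_surj : surjective quot_map.
Proof. by move=> y; exists (repr y); exact: reprK. Qed.

Lemma quot_map_eq0 x : quot_map x = 0 <-> x \in I.
Proof.
have pi0 : 0 = quot_pi 0 by rewrite -[RHS]/(quot_map 0) linear0.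
split=> [/eqP|Ix]; last first.
  apply/eqP; rewrite -[quot_map x]/(quot_pi x) pi0 /quot_pi.
  by rewrite -Quotient.idealrBE subr0.
rewrite -[quot_map x]/(quot_pi x) pi0 /quot_pi.
by rewrite -Quotient.idealrBE subr0.
Qed.

End Submodule.
End Constructions.

(** * Factorizations, short exact sequences, free modules *)

Definition pred_of_Prop (T : Type) (P : T -> Prop) : {pred T} :=
  fun x => `[< P x >].

Lemma in_PropP (T : Type) (P : T -> Prop) x :
  reflect (P x) (x \in pred_of_Prop P).
Proof. exact: asboolP. Qed.

Section LinearAlgebra.
Variable R : pzRingType.
Implicit Types A B C M N P Q L K X Y : lmodType R.

Section Closed.
Variables (M : lmodType R) (N : {pred M}) (clN : submod_closed N).

Lemma submod0 : 0 \in N. Proof. by case: clN. Qed.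

Lemma submodD x y : x \in N -> y \in N -> x + y \in N.
Proof. by case: clN => _ lin Nx Ny; rewrite -[x]scale1r; apply: lin. Qed.

Lemma submodZ a x : x \in N -> a *: x \in N.
Proof. by case: clN => N0 lin Nx; rewrite -[_ *: _]addr0; apply: lin. Qed.

Lemma submodB x y : x \in N -> y \in N -> x - y \in N.
Proof. by move=> Nx Ny; rewrite -scaleN1r; apply/submodD/submodZ. Qed.

Lemma submod_sum I (r : seq I) (F : I -> M) :
  (forall i, F i \in N) -> \sum_(i <- r) F i \in N.
Proof.
move=> NF; elim: r => [|i r IH]; rewrite ?big_nil ?big_cons ?submod0 //.
exact: submodD.
Qed.

End Closed.

Lemma preim_closed M N (f : {linear M -> N}) (I : {pred N}) :
  submod_closed I -> submod_closed (fun x => f x \in I : bool).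
Proof.
move=> [I0 linI]; split=> [|a u v]; rewrite !unfold_in ?linear0 //.
by rewrite linearP; apply: linI.
Qed.

Lemma kernel_closed M N (f : {linear M -> N}) :
  submod_closed (fun x => f x == 0 : bool).
Proof.
split=> [|a u v]; rewrite !unfold_in ?linear0 //.
by rewrite linearP => /eqP-> /eqP->; rewrite scaler0 addr0.
Qed.

Definition kernel M N (f : {linear M -> N}) : lmodType R :=
  sub_module (kernel_closed f).

Lemma kernelP M N (f : {linear M -> N}) :
  exact_at (sub_incl (kernel_closed f)) f.
Proof.
move=> y; split=> [fy0 | [x <-]]; last exact/eqP/(sub_inclP x).
by apply: sub_incl_lift; apply/eqP.
Qed.

(** Well defined because two preimages under p differ by an element of the
    kernel. *)
Lemma factor_surj Q K X (p : {linear Q -> K}) (f : {linear Q -> X}) :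
  surjective p -> (forall q, p q = 0 -> f q = 0) ->
  exists g : {linear K -> X}, forall q, g (p q) = f q.
Proof.
move=> /choice[s sK] ker_f.
have gp q : f (s (p q)) = f q.
  by apply/eqP; rewrite -subr_eq0 -linearB ker_f // linearB sK subrr.
have [|g gE] := @linear_exists R K X (f \o s).
  move=> a x y /=; rewrite -linearP.
  by rewrite -[in RHS]gp linearP !sK.
by exists g => q; rewrite gE /= gp.
Qed.

Lemma factor_inj L Q X (i : {linear L -> Q}) (f : {linear X -> Q}) :
  injective i -> (forall x, exists l, i l = f x) ->
  exists g : {linear X -> L}, forall x, i (g x) = f x.
Proof.
move=> inj_i /choice[s sP].
have [|g gE] := @linear_exists R X L s.
  by move=> a x y; apply: inj_i; rewrite linearP !sP linearP.
by exists g => x; rewrite gE.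
Qed.

Definition short_exact A B C (i : A -> B) (p : B -> C) :=
  [/\ injective i, exact_at i p & surjective p].

Lemma short_exact_kernel M N (f : {linear M -> N}) : surjective f ->
  short_exact (sub_incl (kernel_closed f)) f.
Proof. by move=> sf; split; [exact: sub_incl_inj | exact: kernelP | exact: sf]. Qed.

Lemma short_exact_cokernel L Q (i : {linear L -> Q}) : injective i ->
  exists K (p : {linear Q -> K}), short_exact i p.
Proof.
move=> inj_i; pose I := pred_of_Prop (fun q => exists l, i l = q).
have clI : submod_closed I.
  split; first by apply/in_PropP; exists 0; rewrite linear0.
  move=> a _ _ /in_PropP[u <-] /in_PropP[v <-]; apply/in_PropP.
  by exists (a *: u + v); rewrite linearP.
exists (quotient_module clI), (quot_map clI).
split=> // [q|]; last exact: quot_map_surj.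
by rewrite quot_map_eq0; split=> /in_PropP.
Qed.

Lemma linear_eq0_inj M N (f : {linear M -> N}) :
  (forall x, f x = 0 -> x = 0) -> injective f.
Proof.
move=> ker_f x y /eqP; rewrite -subr_eq0 -linearB => /eqP/ker_f/eqP.
by rewrite subr_eq0 => /eqP.
Qed.

Section Free.
Variable I : choiceType.

Definition finite_support (f : I -> R^o) :=
  exists s : seq I, forall i, i \notin s -> f i = 0.

Definition free_pred : {pred I -> R^o} := pred_of_Prop finite_support.

Lemma free_closed : submod_closed free_pred.
Proof.
split=> [|a f g /in_PropP[s fs] /in_PropP[t gt]]; apply/in_PropP.
  by exists nil.
exists (s ++ t) => i; rewrite mem_cat negb_or => /andP[/fs fi /gt gi].
by rewrite -[LHS]/(a *: f i + g i) fi gi scaler0 addr0.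
Qed.

Definition free_module : lmodType R := sub_module free_closed.

Definition free_coef (f : free_module) : I -> R := sub_incl free_closed f.

Lemma free_supp (f : free_module) :
  exists s : seq I, forall i, i \notin s -> free_coef f i = 0.
Proof. exact/in_PropP/(sub_inclP f). Qed.

Lemma free_coefP a (f g : free_module) i :
  free_coef (a *: f + g) i = a * free_coef f i + free_coef g i.
Proof. by rewrite /free_coef linearP. Qed.

Definition free_basis_fun (i : I) : I -> R^o := fun j => (j == i)%:R.

Lemma free_basis_in i : free_basis_fun i \in free_pred.
Proof.
by apply/in_PropP; exists [:: i] => j; rewrite inE /free_basis_fun => /negPf->.
Qed.

Definition free_basis i : free_module := Sub (free_basis_fun i) (free_basis_in i).

Lemma free_basisE i j : free_coef (free_basis i) j = (j == i)%:R.
Proof. by []. Qed.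

Section Eval.
Variables (X : lmodType R) (phi : I -> X).

(** The support is only known to exist; [free_eval_supp] makes the value
    independent of the list chosen. *)
Definition free_eval_fun (f : free_module) : X :=
  \sum_(i <- undup (projT1 (cid (free_supp f)))) free_coef f i *: phi i.

Lemma free_eval_supp (f : free_module) (s : seq I) : uniq s ->
  (forall i, i \notin s -> free_coef f i = 0) ->
  free_eval_fun f = \sum_(i <- s) free_coef f i *: phi i.
Proof.
rewrite /free_eval_fun; case: cid => t /= ft us fs.
have restrict (u v : seq I) : uniq u -> uniq v ->
    (forall i, i \notin v -> free_coef f i = 0) ->
    \sum_(i <- u) free_coef f i *: phi i =
    \sum_(i <- [seq i <- u | i \in v]) free_coef f i *: phi i.
  move=> uu uv fv; rewrite big_filter [LHS](bigID (fun i => i \in v)) /=.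
  rewrite [X in _ + X]big1 ?addr0 // => i /fv ->.
  by rewrite scale0r.
have ft' i : i \notin undup t -> free_coef f i = 0 by rewrite mem_undup; apply: ft.
rewrite (restrict _ _ (undup_uniq t) us fs).
rewrite (restrict _ _ us (undup_uniq t) ft').
apply: perm_big; apply: uniq_perm; rewrite ?filter_uniq ?undup_uniq //.
by move=> i; rewrite !mem_filter andbC.
Qed.

Lemma free_eval_linear : linear free_eval_fun.
Proof.
move=> a f g; have [s fs] := free_supp f; have [t gt] := free_supp g.
pose u := undup (s ++ t).
have us i : i \notin u -> (i \notin s) && (i \notin t).
  by rewrite mem_undup mem_cat negb_or.
have fu i : i \notin u -> free_coef f i = 0 by move=> /us/andP[/fs].
have gu i : i \notin u -> free_coef g i = 0 by move=> /us/andP[_ /gt].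
have fgu i : i \notin u -> free_coef (a *: f + g) i = 0.
  by move=> ui; rewrite free_coefP fu ?gu // mulr0 addr0.
rewrite !(free_eval_supp (undup_uniq _) fgu, free_eval_supp (undup_uniq _) fu).
rewrite (free_eval_supp (undup_uniq _) gu) scaler_sumr -big_split /=.
by apply: eq_bigr => i _; rewrite free_coefP scalerDl scalerA.
Qed.

Lemma free_eval : exists h : {linear free_module -> X},
  forall i, h (free_basis i) = phi i.
Proof.
have [h hE] := linear_exists free_eval_linear; exists h => i.
rewrite hE (@free_eval_supp _ [:: i]) // => [|j].
  by rewrite big_seq1 free_basisE eqxx scale1r.
by rewrite inE free_basisE => /negPf->.
Qed.

End Eval.

Lemma free_spanned (f : free_module) : exists s : seq I,
  f = \sum_(i <- s) free_coef f i *: free_basis i.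
Proof.
have [s fs] := free_supp f; exists (undup s).
apply: (@sub_incl_inj _ _ _ free_closed); apply/funext => j.
rewrite linear_sum fct_sumE.
rewrite -[LHS]/(free_coef f j).
have termE i : sub_incl free_closed (free_coef f i *: free_basis i) j =
    free_coef f i * (j == i)%:R by rewrite linearZ.
rewrite (eq_bigr _ (fun i _ => termE i)).
have [sj | nsj] := boolP (j \in undup s).
  rewrite (bigD1_seq j) ?undup_uniq //= eqxx mulr1 big1 ?addr0 // => i.
  by rewrite eq_sym => /negPf->; rewrite mulr0.
rewrite big_seq big1 => [|i si]; first by rewrite fs // -mem_undup.
by case: eqP nsj => [->|]; rewrite ?si ?mulr0.
Qed.

Lemma free_ext X (f g : {linear free_module -> X}) :
  (forall i, f (free_basis i) = g (free_basis i)) -> f =1 g.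
Proof.
move=> fg x; have [s ->] := free_spanned x; rewrite !linear_sum.
by apply: eq_bigr => i _; rewrite !linearZ /= fg.
Qed.

Lemma free_projective : projective free_module.
Proof.
move=> A B g f /choice[s sK].
have [h hE] := free_eval (fun i => s (f (free_basis i))).
by exists h; apply: (@free_ext _ (g \o h) f) => i /=; rewrite hE sK.
Qed.

End Free.

Lemma enough_projectives M :
  exists Q (p : {linear Q -> M}), projective Q /\ surjective p.
Proof.
have [p pE] := @free_eval M M id; exists (free_module M), p.
by split=> [|x]; [exact: free_projective | exists (free_basis x)].
Qed.

Lemma projective_retract P Q (s : {linear P -> Q}) (r : {linear Q -> P}) :
  projective Q -> (forall x, r (s x) = x) -> projective P.
Proof.
move=> projQ rs A B g f surj_g.
have [h hE] := projQ A B g (f \o r) surj_g.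
by exists (h \o s) => x /=; rewrite hE /= rs.
Qed.

Lemma regular_projective : projective R^o.
Proof.
move=> A B g f surj_g; have [a aE] := surj_g (f 1).
have [|h hE] := @linear_exists R R^o A (fun r : R^o => (r : R) *: a).
  by move=> r x y; rewrite scalerDl scalerA.
exists h => x; rewrite hE linearZ /= aE -linearZ.
by rewrite -[_ *: _]/(x * 1) mulr1.
Qed.

Lemma zero_projective P : zero_module P -> projective P.
Proof.
move=> P0 A B g f _; have [|h hE] := @linear_exists R P A (fun=> 0).
  by move=> a x y; rewrite scaler0 addr0.
by exists h => x; rewrite [x]P0 !linear0.
Qed.

Lemma zero_injective P : zero_module P -> injective_module P.
Proof.
move=> P0 A B g f _; have [|h hE] := @linear_exists R B P (fun=> 0).
  by move=> a x y; rewrite scaler0 addr0.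
by exists h => x; rewrite [LHS]P0 [RHS]P0.
Qed.

Lemma zero_module_exists : exists Z : lmodType R, zero_module Z.
Proof. by exists 'rV[R]_0 => x; apply/rowP; case. Qed.

End LinearAlgebra.

(** * Extending partial linear maps by Zorn's lemma *)

Section Baer.
Variables (R : pzRingType) (B N : lmodType R).

(** A partially defined linear map from B to N, given by its graph. Working
    with graphs lets Zorn's lemma run over predicates, without types for the
    domains. *)
Definition linear_graph (G : {pred B * N}) :=
  submod_closed G /\ (forall y, (0, y) \in G -> y = 0).

Lemma linear_graph_fun G x y z :
  linear_graph G -> (x, y) \in G -> (x, z) \in G -> y = z.
Proof.
move=> [clG funG] Gy Gz; apply/eqP; rewrite -subr_eq0; apply/eqP/funG.
by rewrite -(subrr x); apply: (submodB clG Gy Gz).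
Qed.

Lemma linear_graphP G x y x' y' a : linear_graph G ->
  (x, y) \in G -> (x', y') \in G -> (a *: x + x', a *: y + y') \in G.
Proof. by move=> [[_ linG] _] Gx Gx'; apply: (linG a _ _ Gx Gx'). Qed.

Lemma maximal_linear_graph G : linear_graph G ->
  exists G', [/\ linear_graph G', {subset G <= G'} &
    forall G'', linear_graph G'' -> {subset G' <= G''} -> {subset G'' <= G'}].
Proof.
move=> lgG.
pose T := {G' : {pred B * N} | linear_graph G' /\ {subset G <= G'}}.
pose r (s t : T) := `[< {subset sval s <= sval t} >].
have [|||t tmax] := @ZL_preorder T (exist _ G (conj lgG (fun _ => id))) r.
- by move=> s; apply/asboolP.
- by move=> s t u /asboolP st /asboolP tu; apply/asboolP => x /st/tu.
- move=> A totA.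
  pose U := pred_of_Prop (fun z => z \in G \/ exists2 s, A s & z \in sval s).
  have join z w : z \in U -> w \in U ->
      exists2 H, linear_graph H /\ {subset H <= U} & z \in H /\ w \in H.
    have subU s : A s -> {subset sval s <= U}.
      by move=> As v sv; apply/in_PropP; right; exists s.
    have lgs s : A s -> linear_graph (sval s) /\ {subset sval s <= U}.
      by move=> As; split; [have [] := proj2_sig s | apply: subU].
    have Gs (s : T) : {subset G <= sval s} by have [] := proj2_sig s.
    move=> /in_PropP[Gz|[s As sz]] /in_PropP[Gw|[t At tw]].
    + exists G => //; split=> // v Gv; apply/in_PropP; by left.
    + by exists (sval t); [exact: lgs | split=> //; apply: Gs].
    + by exists (sval s); [exact: lgs | split=> //; apply: Gs].
    have [/asboolP st|/asboolP ts] := totA _ _ As At.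
      by exists (sval t); [exact: lgs | split=> //; apply: st].
    by exists (sval s); [exact: lgs | split=> //; apply: ts].
  have U0 : 0 \in U by apply/in_PropP; left; case: lgG => -[].
  have goodU : linear_graph U /\ {subset G <= U}.
    split; last by move=> v Gv; apply/in_PropP; left.
    split; first split=> // a u v Uu Uv.
      have [H [[[_ linH] _] sHU] [Hu Hv]] := join _ _ Uu Uv.
      exact/sHU/linH.
    move=> y Uy; have [H [[_ funH] _] [Hy _]] := join _ _ Uy U0.
    exact: funH.
  exists (exist _ U goodU) => s As; apply/asboolP => v sv.
  by apply/in_PropP; right; exists s.
have [lgt Gt] := proj2_sig t; exists (sval t); split=> // G'' lgG'' tG''.
have goodG'' : linear_graph G'' /\ {subset G <= G''} by split=> // v /Gt/tG''.
by have /(_ _)/asboolP := tmax (exist _ G'' goodG''); apply; apply/asboolP.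
Qed.

(** Baer's argument: a maximal graph containing G is defined everywhere,
    because at any b the map a |-> G' (a b) on a left ideal is multiplication
    by some n, and then b |-> n enlarges G'. The one-step hypothesis is stated
    for the extensions of G only, so that it covers both injectivity over the
    integers and the splitting of modules killed by a semiprimary ideal. *)
Lemma extend_linear_graph G : linear_graph G ->
  (forall G', linear_graph G' -> {subset G <= G'} ->
    forall b, exists n, forall a y, (a *: b, y) \in G' -> y = a *: n) ->
  exists h : {linear B -> N}, forall x y, (x, y) \in G -> h x = y.
Proof.
move=> lgG step; have [G' [lgG' sGG' maxG']] := maximal_linear_graph lgG.
have total b : exists y, (b, y) \in G'.
  have [n nP] := step _ lgG' sGG' b; exists n.
  pose G'' := pred_of_Prop (fun z : B * N =>
    exists a x y, (x, y) \in G' /\ z = (a *: b + x, a *: n + y)).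
  have cl0 := submod0 lgG'.1.
  apply: (maxG' G''); last first.
  - by apply/in_PropP; exists 1, 0, 0; rewrite !scale1r !addr0.
  - by move=> [x y] Gxy; apply/in_PropP; exists 0, x, y; rewrite !scale0r !add0r.
  split; first split.
  - by apply/in_PropP; exists 0, 0, 0; rewrite !scale0r !addr0.
  - move=> c _ _ /in_PropP[a [x [y [Gxy ->]]]] /in_PropP[a' [x' [y' [Gxy' ->]]]].
    apply/in_PropP; exists (c * a + a'), (c *: x + x'), (c *: y + y').
    split; first exact: linear_graphP.
    by rewrite !scalerDl -!scalerA !(addrACA _ _ (c *: _)) -!scalerDr.
  move=> z /in_PropP[a [x [y [Gxy [/eqP bx ->]]]]].
  have /nP <- : (a *: b, - y) \in G'.
    move: bx; rewrite eq_sym addr_eq0 => /eqP->.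
    have /= := linear_graphP (-1) lgG' Gxy cl0.
    by rewrite !scaleN1r !addr0.
  by rewrite addNr.
have [h hG] := choice total.
have [|g gE] := @linear_exists R B N h.
  move=> a x y; apply: (linear_graph_fun lgG' (hG _)).
  exact: linear_graphP.
by exists g => x y /sGG' Gxy; rewrite gE; apply: (linear_graph_fun lgG' (hG x)).
Qed.

End Baer.

(** * The divisible group Q/Z *)

Lemma int_closed : submod_closed (fun q : zmodule rat => q \is a Num.int).
Proof.
split=> [|a u v]; rewrite !unfold_in; first exact: rpred0.
move=> u_int v_int; apply: rpredD => //.
by rewrite scalezrE; apply: rpredMz.
Qed.

Definition QZ : lmodType int := quotient_module int_closed.

Definition qz (q : rat) : QZ := quot_map int_closed q.

Lemma qz_eq0 q : qz q = 0 <-> q \is a Num.int.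
Proof. exact: quot_map_eq0. Qed.

Lemma qzZ (a : int) q : a *: qz q = qz (a%:~R * q).
Proof.
rewrite /qz -linearZ; congr (quot_map _ _).
by rewrite scalezrE mulrzl.
Qed.

Lemma QZ_divisible (n : nat) (w : QZ) : (0 < n)%N -> exists w', w = n%:Z *: w'.
Proof.
move=> n_gt0; have [q <-] := quot_map_surj w.
exists (qz ((q : rat) / n%:R)); rewrite qzZ mulrC divfK // pmulrn //.
by rewrite intr_eq0 -lt0n.
Qed.

Lemma int_ideal_generator (I : {pred int^o}) : submod_closed I ->
  exists n : nat, forall a : int, a \in I <-> exists q : int, a = q * n%:Z.
Proof.
move=> clI; have IM (q a : int) : a \in I -> q * a \in I by apply: (submodZ clI).
have IB (a b : int) : a \in I -> b \in I -> a - b \in I.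
  exact: (@submodB _ _ _ clI a b).
have [exn | noexn] := pselect (exists n : nat, (0 < n)%N && (n%:Z \in I)).
  case: (ex_minnP exn) => n /andP[n_gt0 In] minn; exists n => a.
  split=> [Ia | [q ->]]; last exact: IM.
  exists (a %/ n%:Z)%Z; apply/eqP; rewrite -subr_eq0.
  have r_def : (a %% n%:Z)%Z = a - (a %/ n%:Z)%Z * n%:Z by [].
  have : (a %% n%:Z)%Z \in I by rewrite r_def; exact: IB Ia (IM _ _ In).
  rewrite -r_def; have n0 : n%:Z != 0 by rewrite eqz_nat -lt0n.
  have := ltz_mod a n0; have := modz_ge0 a n0.
  case: (a %% n%:Z)%Z => // [[|r]] // _ ltrn Ir.
  have := minn r.+1; rewrite Ir /= => /(_ isT).
  by rewrite leqNgt -ltz_nat ltrn.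
exists 0%N => a; split=> [Ia | [q ->]]; last by rewrite mulr0; exact: (submod0 clI).
exists 0; rewrite mul0r; apply: contrapT => /eqP a0; apply: noexn.
exists `|a|%N; rewrite absz_gt0 a0 /=.
by rewrite abszE -[`|a|]mulr1 normrEsg mulr1; apply: IM.
Qed.

(** The integers are principal and Q/Z is divisible, so Baer's one-step
    condition holds: if n generates the ideal of the a with a b in the domain,
    divide the value at n b by n. *)
Lemma QZ_extend_graph (B : lmodType int) (G : {pred B * QZ}) : linear_graph G ->
  exists h : {linear B -> QZ}, forall x y, (x, y) \in G -> h x = y.
Proof.
move=> lgG; apply: extend_linear_graph => // G' lgG' _ b.
pose I := pred_of_Prop (fun a : int^o => exists y, ((a : int) *: b, y) \in G').
have clI : submod_closed I.
  split; first by apply/in_PropP; exists 0; rewrite scale0r (submod0 lgG'.1).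
  move=> c u v /in_PropP[y Gy] /in_PropP[z Gz]; apply/in_PropP.
  exists (c *: y + z); rewrite scalerDl -scalerA.
  exact: linear_graphP.
have [n nP] := int_ideal_generator clI.
have /in_PropP[y0 Gy0] : (n%:Z : int^o) \in I by apply/nP; exists 1; rewrite mul1r.
have [w wP] : exists w, y0 = n%:Z *: w.
  case: n Gy0 {nP} => [|n] Gy0; last exact: QZ_divisible.
  by exists 0; rewrite scaler0; apply: lgG'.2; rewrite -[0](scale0r b).
exists w => a y Gy.
have [q qE] : exists q : int, a = q * n%:Z.
  by apply/nP; apply/in_PropP; exists y.
have := linear_graphP q lgG' Gy0 (submod0 lgG'.1).
rewrite !addr0 scalerA -qE => /(linear_graph_fun lgG' Gy) ->.
by rewrite wP scalerA -qE.
Qed.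

Section AdditiveMaps.
Implicit Types U V : zmodType.

Lemma linear_of_morph U (f : U -> QZ) : {morph f : x y / x + y} ->
  exists g : {linear zmodule U -> QZ}, g =1 f.
Proof.
move=> fD; have f0 : f 0 = 0.
  by apply: (addrI (f 0)); rewrite -fD !addr0.
have fN x : f (- x) = - f x.
  by apply/eqP; rewrite -addr_eq0 -fD addNr f0.
apply: linear_exists => a x y; rewrite scalezrE fD; congr (_ + _).
have fMn n z : f (z *+ n) = n%:Z *: f z.
  elim: n => [|n IH]; first by rewrite mulr0n scale0r.
  by rewrite mulrS fD IH intS scalerDl scale1r.
case: a => n; rewrite ?NegzE; first exact: fMn.
by rewrite -nmulrn fN fMn scaleNr.
Qed.

(** The multiples k x that fall in A form an ideal nZ with n <> 1, and sending
    x to 1/n (to 1/2 when n = 0) is consistent with being 0 on A. Together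
    with [QZ_extends] this makes Q/Z an injective cogenerator. *)
Lemma QZ_separates U (A : {pred U}) (x : U) : zmod_closed A -> x \notin A ->
  exists f : U -> QZ, [/\ {morph f : y z / y + z},
    forall a, a \in A -> f a = 0 & f x <> 0].
Proof.
move=> [A0 AB] nAx; pose B := zmodule U.
have AN a : a \in A -> - a \in A by move=> Aa; rewrite -sub0r AB.
have AD a b : a \in A -> b \in A -> a + b \in A.
  by move=> Aa Ab; rewrite -[b]opprK AB // AN.
have clA : submod_closed (A : {pred B}).
  split=> // c u v Au Av; rewrite AD // scalezrE.
  case: c => n; rewrite ?NegzE -?nmulrn -?pmulrn ?AN //.
    by elim: n => [|n IH]; rewrite ?mulr0n // mulrS AD.
  by elim: n => [|n IH]; rewrite ?mulr1n // mulrS AD.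
pose I : {pred int^o} := fun a : int => (a *: (x : B)) \in A.
have clI : submod_closed I.
  split; first by rewrite unfold_in /I scale0r.
  by move=> c u v Iu Iv; rewrite unfold_in /I scalerDl -scalerA; apply: clA.2.
have [n nP] := int_ideal_generator clI.
have n1 : n != 1%N.
  apply: contra nAx => /eqP n1; rewrite -[x](scale1r (x : B)).
  by apply/(nP 1); exists 1; rewrite n1.
have [w w0 wI] : exists2 w : QZ, w <> 0 & forall a : int, a \in I -> a *: w = 0.
  case: n nP n1 => [|n] nP n1.
    exists (qz (2%:Q)^-1); first by move=> /qz_eq0.
    by move=> a /nP[q ->]; rewrite mulr0 scale0r.
  exists (qz (n.+1%:Q)^-1).
    move=> /qz_eq0/intrP[m /esym mE].
    have /intr_inj m1 : (m * n.+1)%:~R = 1%:~R :> rat.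
      by rewrite intrM mE mulVf // intr_eq0.
    have : (n.+1 %| 1)%Z by apply/dvdzP; exists m; rewrite m1.
    by rewrite dvdz1 /= => /eqP[n0]; rewrite n0 in n1.
  move=> a /nP[q ->]; rewrite qzZ; apply/qz_eq0.
  by rewrite intrM mulfK ?intr_eq0 // rpred_int.
pose G := pred_of_Prop (fun z : B * QZ =>
  exists k : int, z.1 - k *: (x : B) \in A /\ z.2 = k *: w).
have lgG : linear_graph G.
  split; first split.
  - by apply/in_PropP; exists 0; rewrite !scale0r subr0.
  - move=> c [u1 u2] [v1 v2] /in_PropP[k /= [Au ->]] /in_PropP[l /= [Av ->]].
    apply/in_PropP; exists (c * k + l) => /=; split; last by rewrite scalerDl scalerA.
    rewrite scalerDl -scalerA opprD addrACA -scalerBr.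
    by apply: clA.2.
  move=> y /in_PropP[k /= [Ak ->]]; apply: wI; rewrite unfold_in /I.
  by rewrite -[_ *: _]opprK AN // -sub0r.
have [h hG] := QZ_extend_graph lgG.
exists h; split=> [y z | a Aa |]; first exact: (linearD h).
  by apply: hG; apply/in_PropP; exists 0; rewrite !scale0r subr0.
rewrite (hG x w) //; apply/in_PropP; exists 1.
by rewrite !scale1r subrr.
Qed.

Lemma QZ_extends U V (g : U -> V) (f : U -> QZ) :
    {morph g : x y / x + y} -> injective g -> {morph f : x y / x + y} ->
  exists h : V -> QZ, {morph h : x y / x + y} /\ forall x, h (g x) = f x.
Proof.
move=> gD inj_g fD; have [f' f'E] := linear_of_morph fD.
have g0 : g 0 = 0 by apply: (addrI (g 0)); rewrite -gD !addr0.
have gN x : g (- x) = - g x by apply/eqP; rewrite -addr_eq0 -gD addNr g0.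
have gZ (c : int) (u : zmodule U) : g (c *: u) = c *: (g u : zmodule V).
  have gMn n z : g (z *+ n) = g z *+ n.
    by elim: n => [|n IH]; rewrite ?mulr0n // !mulrS gD IH.
  rewrite !scalezrE; case: c => n; rewrite ?NegzE -?nmulrn -?pmulrn ?gN gMn //.
pose G := pred_of_Prop (fun z : zmodule V * QZ => exists u, z = (g u, f u)).
have lgG : linear_graph G.
  split; first split.
  - by apply/in_PropP; exists 0; rewrite g0 -f'E linear0.
  - move=> c _ _ /in_PropP[u ->] /in_PropP[v ->]; apply/in_PropP.
    exists (c *: (u : zmodule U) + v); rewrite gD gZ -!f'E.
    by rewrite (linearP f').
  move=> y /in_PropP[u [gu0 ->]]; rewrite -f'E.
  have -> : u = 0 by apply: inj_g; rewrite g0.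
  by rewrite linear0.
have [h hG] := QZ_extend_graph lgG; exists h.
split=> [x y | x]; first exact: (linearD h).
by apply: hG; apply/in_PropP; exists x.
Qed.

End AdditiveMaps.

(** * Character modules *)

Definition additive_pred (U : zmodType) : {pred U -> QZ} :=
  pred_of_Prop (fun f => {morph f : x y / x + y}).

Lemma additive_closed U : submod_closed (@additive_pred U).
Proof.
split=> [|a f g /in_PropP fD /in_PropP gD]; apply/in_PropP => x y.
  by rewrite -[LHS]/(0 : QZ) -[RHS]/(0 + 0 : QZ) addr0.
by rewrite -[LHS]/(a *: f (x + y) + g (x + y)) fD gD scalerDr addrACA.
Qed.

(** The character module Hom_Z(M, Q/Z). The scalars act through an
    antihomomorphism op, given as a morphism into the converse ring; keeping
    op abstract gives the dual of right modules and that of left modules at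
    once. *)
Definition dual (R R' : pzRingType) (op : {rmorphism R' -> R^c})
  (M : lmodType R) : Type := sub_module (@additive_closed M).

Section Dual.
Variables (R R' : pzRingType) (op : {rmorphism R' -> R^c}).

Section OneModule.
Variable M : lmodType R.

Local Notation D := (dual op M).
HB.instance Definition _ := GRing.Zmodule.on D.

Definition dual_fun (d : D) : M -> QZ := sub_incl (additive_closed M) d.

Lemma dual_ext (d e : D) : dual_fun d =1 dual_fun e -> d = e.
Proof. by move=> /funext; apply: sub_incl_inj. Qed.

Lemma dual_funDr (d : D) : {morph dual_fun d : x y / x + y}.
Proof. exact/in_PropP/(sub_inclP d). Qed.

Definition dual_of (f : M -> QZ) (fD : {morph f : x y / x + y}) : D :=
  Sub f (introT (in_PropP _ _) fD).

Lemma dual_ofE f fD : dual_fun (@dual_of f fD) = f. Proof. by []. Qed.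

Lemma dual_funDl (d e : D) x : dual_fun (d + e) x = dual_fun d x + dual_fun e x.
Proof. by []. Qed.

Fact dual_scale_subproof (a : R') (d : D) :
  {morph (fun x : M => dual_fun d ((op a : R) *: x)) : x y / x + y}.
Proof. by move=> x y /=; rewrite scalerDr dual_funDr. Qed.

Definition dual_scale a d := dual_of (dual_scale_subproof a d).

Fact dual_scalerA a b d : dual_scale a (dual_scale b d) = dual_scale (a * b) d.
Proof.
by apply: dual_ext => x; rewrite !dual_ofE rmorphM scalerA.
Qed.

Fact dual_scale1r : left_id 1 dual_scale.
Proof. by move=> d; apply: dual_ext => x; rewrite dual_ofE rmorph1 scale1r. Qed.

Fact dual_scalerDr : right_distributive dual_scale +%R.
Proof. by move=> a d e; apply: dual_ext => x; rewrite dual_funDl !dual_ofE. Qed.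

Fact dual_scalerDl d : {morph dual_scale^~ d : a b / a + b}.
Proof.
move=> a b; apply: dual_ext => x; rewrite dual_funDl !dual_ofE rmorphD.
by rewrite scalerDl dual_funDr.
Qed.

HB.instance Definition _ := GRing.Zmodule_isLmodule.Build R' D
  dual_scalerA dual_scale1r dual_scalerDr dual_scalerDl.

End OneModule.

Lemma dual_funZ (M : lmodType R) a (d : dual op M) x :
  dual_fun (a *: d) x = dual_fun d ((op a : R) *: x).
Proof. by []. Qed.

Lemma dual_fun0r (M : lmodType R) (d : dual op M) : dual_fun d 0 = 0.
Proof. by apply: (addrI (dual_fun d 0)); rewrite -dual_funDr !addr0. Qed.

Section DualMap.
Variables (M N : lmodType R) (f : {linear M -> N}).

Fact dual_map_subproof (d : dual op N) :
  {morph (fun x => dual_fun d (f x)) : x y / x + y}.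
Proof. by move=> x y /=; rewrite linearD dual_funDr. Qed.

Definition dual_map_fun d : dual op M := dual_of (dual_map_subproof d).

Fact dual_map_linear : linear dual_map_fun.
Proof.
by move=> a d e; apply: dual_ext => x; rewrite /dual_map_fun dual_funDl dual_funZ
  !dual_ofE dual_funDl dual_funZ linearZ.
Qed.
HB.instance Definition _ :=
  GRing.isLinear.Build R' (dual op N) (dual op M) *:%R dual_map_fun
    dual_map_linear.

Definition dual_map : {linear dual op N -> dual op M} := dual_map_fun.

Lemma dual_mapE d x : dual_fun (dual_map d) x = dual_fun d (f x).
Proof. by []. Qed.

End DualMap.

Lemma dual_map_surj (M N : lmodType R) (f : {linear M -> N}) :
  injective f -> surjective (dual_map f).
Proof.
move=> inj_f d.
have [h [hD hf]] := QZ_extends (linearD f) inj_f (dual_funDr d).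
by exists (dual_of hD); apply: dual_ext => x; rewrite dual_mapE dual_ofE hf.
Qed.

Lemma dual_short_exact (A B C : lmodType R) (i : {linear A -> B}) (p : {linear B -> C}) :
  short_exact i p -> short_exact (dual_map p) (dual_map i).
Proof.
move=> [inj_i ex surj_p]; split; last exact: dual_map_surj.
  move=> d e de; apply: dual_ext => x; have [y <-] := surj_p x.
  by rewrite -!dual_mapE de.
move=> d; split=> [d0 | [e <-]]; last first.
  apply: dual_ext => x; rewrite !dual_mapE.
  have -> : p (i x) = 0 by apply/ex; exists x.
  exact: dual_fun0r.
have [s sK] := choice surj_p.
have d_ker y : p y = 0 -> dual_fun d y = 0.
  by move=> /ex[x <-]; rewrite -dual_mapE d0.
have dB y z : p y = p z -> dual_fun d y = dual_fun d z.
  move=> pyz; have : dual_fun d (y - z + z) = dual_fun d z.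
    by rewrite dual_funDr d_ker ?add0r // linearB pyz subrr.
  by rewrite subrK.
have eD : {morph (fun x => dual_fun d (s x)) : x y / x + y}.
  by move=> x y /=; rewrite -dual_funDr; apply: dB; rewrite linearD !sK.
exists (dual_of eD); apply: dual_ext => y; rewrite dual_mapE dual_ofE.
by apply: dB; rewrite sK.
Qed.

End Dual.

Arguments dual_of {R R'} op {M f} fD.
Arguments dual_map {R R'} op {M N} f.
Arguments dual_map_surj {R R'} op {M N} f.

(** Transposition: a map A -> dual P is a map P -> dual A, and dual B -> dual
    A is onto when A embeds in B, so it lifts along the projective P and is
    transposed back. *)
Lemma dual_injective (R R' : pzRingType) (op : {rmorphism R' -> R^c})
    (op' : {rmorphism R -> R'^c}) (P : lmodType R) :
    (forall a, op (op' a) = a) -> (forall a, op' (op a) = a) ->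
  projective P -> injective_module (dual op P).
Proof.
move=> opK op'K projP A B g f inj_g.
have tD p : {morph (fun x => dual_fun (f x) p) : x y / x + y}.
  by move=> x y; rewrite linearD dual_funDl.
have [|t tE] := @linear_exists R P (dual op' A) (fun p => dual_of op' (tD p)).
  move=> a p q; apply: dual_ext => x; rewrite dual_funDl dual_funZ !dual_ofE.
  by rewrite linearZ dual_funZ opK dual_funDr.
have [h hE] := projP _ _ (dual_map op' g) t (dual_map_surj op' _ inj_g).
have uD y : {morph (fun p => dual_fun (h p) y) : p q / p + q}.
  by move=> p q; rewrite linearD dual_funDl.
have [|u uE] := @linear_exists R' B (dual op P) (fun y => dual_of op (uD y)).
  move=> a x y; apply: dual_ext => p; rewrite dual_funDl dual_funZ !dual_ofE.
  by rewrite linearZ dual_funZ op'K dual_funDr.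
by exists u => x; apply: dual_ext => p; rewrite uE dual_ofE -dual_mapE hE tE.
Qed.

(** * Chains of syzygies and cosyzygies *)

Section Staircase.
Variable R : pzRingType.
Implicit Types A B C M P Q L K X Y : lmodType R.

(** When L -> Q -> K is short exact with Q projective, this says Ext^1(K, N) =
    0. *)
Definition extendable L Q (i : {linear L -> Q}) (N : lmodType R) :=
  forall f : {linear L -> N}, exists g : {linear Q -> N}, forall x, g (i x) = f x.

(** When N0 -> E -> N is short exact with E injective, this says Ext^1(K, N0)
    = 0. *)
Definition liftable K (E N : lmodType R) (q : {linear E -> N}) :=
  forall f : {linear K -> N}, exists g : {linear K -> E}, forall x, q (g x) = f x.

Section OneStep.
Variables (L Q K N E N' : lmodType R).
Variables (i : {linear L -> Q}) (p : {linear Q -> K}).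
Variables (j : {linear N -> E}) (q : {linear E -> N'}).
Hypotheses (exQ : short_exact i p) (projQ : projective Q).
Hypotheses (exE : short_exact j q) (injE : injective_module E).

Let pi0 x : p (i x) = 0. Proof. by case: exQ => _ ex _; apply/ex; exists x. Qed.
Let qj0 x : q (j x) = 0. Proof. by case: exE => _ ex _; apply/ex; exists x. Qed.

(** Both sides express Ext^1(K, N) = 0, one through a projective module
    mapping onto K, the other through an injective module containing N. *)
Lemma extendable_liftable : extendable i N <-> liftable K q.
Proof.
have [inj_i ex_i surj_p] := exQ; have [inj_j ex_j surj_q] := exE.
split=> [ext f | lift f].
  have [h hE] := projQ (f \o p) surj_q.
  have [|u uE] := @factor_inj _ _ _ _ j (h \o i) inj_j.
    by move=> x; apply/ex_j; rewrite hE /= pi0 linear0.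
  have [g gE] := ext u.
  have [|v vE] := @factor_surj _ _ _ _ p (h \- (j \o g)) surj_p.
    by move=> _ /ex_i[x <-] /=; rewrite gE uE /= subrr.
  exists v => y; have [x <-] := surj_p y.
  by rewrite vE /= linearB qj0 subr0 hE.
have [h hE] := injE (j \o f) inj_i.
have [|v vE] := @factor_surj _ _ _ _ p (q \o h) surj_p.
  by move=> _ /ex_i[x <-] /=; rewrite hE /= qj0.
have [w wE] := lift v.
have [|g gE] := @factor_inj _ _ _ _ j (h \- (w \o p)) inj_j.
  by move=> x; apply/ex_j; rewrite /= linearB wE vE subrr.
by exists g => x; apply: inj_j; rewrite gE /= pi0 linear0 subr0 hE.
Qed.

(** A map f from L to N' extends to Q if and only if it lifts to E: a lift
    extends by injectivity of E, an extension lifts by projectivity of Q. In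
    terms of Ext the equivalence is that of Ext^1(L, N) = 0 and Ext^1(K, N') =
    0. *)
Lemma liftable_extendable : liftable L q <-> extendable i N'.
Proof.
have [inj_i _ _] := exQ; have [_ _ surj_q] := exE.
split=> [lift f | ext f].
  have [g gE] := lift f; have [h hE] := injE g inj_i.
  by exists (q \o h) => x /=; rewrite hE gE.
have [g gE] := ext f; have [h hE] := projQ g surj_q.
by exists (h \o i) => x /=; rewrite hE gE.
Qed.

End OneStep.

(** A projective resolution of [syzygy 0] cut into short exact sequences; it
    does not stop, so that syzygies of every order are available. *)
Record proj_chain := ProjChain {
  syzygy : nat -> lmodType R;
  pc_proj : nat -> lmodType R;
  pc_incl : forall n, {linear syzygy n.+1 -> pc_proj n};
  pc_cover : forall n, {linear pc_proj n -> syzygy n};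
  pc_exact : forall n, short_exact (pc_incl n) (pc_cover n);
  pc_projective : forall n, projective (pc_proj n) }.

Record inj_chain := InjChain {
  cosyzygy : nat -> lmodType R;
  ic_inj : nat -> lmodType R;
  ic_incl : forall n, {linear cosyzygy n -> ic_inj n};
  ic_quot : forall n, {linear ic_inj n -> cosyzygy n.+1};
  ic_exact : forall n, short_exact (ic_incl n) (ic_quot n);
  ic_injective : forall n, injective_module (ic_inj n) }.

Section Chains.
Variables (c : proj_chain) (d : inj_chain).

Let ext_lift m n :
  extendable (pc_incl c m) (cosyzygy d n) <-> liftable (syzygy c m) (ic_quot d n).
Proof.
exact: (extendable_liftable (pc_exact c m) (@pc_projective c m) (ic_exact d n)
  (@ic_injective d n)).
Qed.

(** Dimension shifting: either side says Ext^(m+n+1)(syzygy 0, cosyzygy 0) =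
    0. Each step of the staircase trades one syzygy for one cosyzygy. *)
Lemma staircase m n :
  extendable (pc_incl c m) (cosyzygy d n) <->
  liftable (syzygy c 0) (ic_quot d (m + n)).
Proof.
elim: m n => [|m IH] n; first exact: ext_lift.
have shift : liftable (syzygy c m.+1) (ic_quot d n) <->
    extendable (pc_incl c m) (cosyzygy d n.+1).
  exact: (liftable_extendable (pc_exact c m) (@pc_projective c m) (ic_exact d n)
    (@ic_injective d n)).
by rewrite addSnnS -IH -shift.
Qed.

Lemma extend_syzygy n :
  injective_module (cosyzygy d n) -> extendable (pc_incl c n) (cosyzygy d 0).
Proof.
move=> inj_n; apply/staircase; rewrite addn0 -[n]add0n; apply/staircase => f.
by apply: inj_n; case: (pc_exact c 0).
Qed.

Lemma lift_to_coresolution n :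
  projective (syzygy c n) -> liftable (syzygy c 0) (ic_quot d n).
Proof.
move=> proj_n; rewrite -[n]addn0; apply/staircase/ext_lift => f.
by apply: proj_n; case: (ic_exact d 0).
Qed.

End Chains.

Definition proj_chain_tail (c : proj_chain) : proj_chain :=
  @ProjChain (fun n => syzygy c n.+1) (fun n => pc_proj c n.+1)
    (fun n => pc_incl c n.+1) (fun n => pc_cover c n.+1)
    (fun n => pc_exact c n.+1) (fun n => @pc_projective c n.+1).

Lemma proj_chain_cons L Q M (i : {linear L -> Q}) (p : {linear Q -> M})
    (c : proj_chain) : short_exact i p -> projective Q -> syzygy c 0 = L ->
  exists c', syzygy c' 0 = M /\ forall n, syzygy c' n.+1 = syzygy c n.
Proof.
move=> ex projQ E; subst L.
pose K n := if n is n'.+1 then syzygy c n' else M.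
pose P n := if n is n'.+1 then pc_proj c n' else Q.
pose i' n : {linear K n.+1 -> P n} :=
  match n with 0 => i | n'.+1 => pc_incl c n' end.
pose p' n : {linear P n -> K n} :=
  match n with 0 => p | n'.+1 => pc_cover c n' end.
have ex' n : short_exact (i' n) (p' n) by case: n => // n; apply: pc_exact.
have proj' n : projective (P n) by case: n => // n; apply: pc_projective.
by exists (ProjChain ex' proj').
Qed.

Lemma zero_proj_chain : exists c, forall n, zero_module (syzygy c n).
Proof.
have [Z Z0] := zero_module_exists R.
have ex (n : nat) : short_exact (idfun : {linear Z -> Z}) (idfun : {linear Z -> Z}).
  split=> // [y | y]; last by exists y.
  by split=> [y0|_]; [exists 0; rewrite (Z0 y) | rewrite (Z0 y)].
by exists (@ProjChain (fun=> Z) (fun=> Z) (fun=> idfun) (fun=> idfun) ex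
  (fun _ => zero_projective Z0)).
Qed.

Lemma proj_chain_exists M : exists c, syzygy c 0 = M.
Proof.
have cover (X : lmodType R) : exists s : {L : lmodType R & {Q : lmodType R &
    ({linear L -> Q} * {linear Q -> X})%type}},
    short_exact (projT2 (projT2 s)).1 (projT2 (projT2 s)).2 /\
    projective (projT1 (projT2 s)).
  have [Q [p [projQ surj_p]]] := enough_projectives X.
  exists (existT _ (kernel p) (existT _ Q (sub_incl (kernel_closed p), p))).
  by split=> //; apply: short_exact_kernel.
pose f X := projT1 (cid (cover X)); have fP X := projT2 (cid (cover X)).
pose K := fix K n : lmodType R := if n is n'.+1 then projT1 (f (K n')) else M.
pose P n := projT1 (projT2 (f (K n))).
by exists (@ProjChain K P (fun n => (projT2 (projT2 (f (K n)))).1)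
  (fun n => (projT2 (projT2 (f (K n)))).2) (fun n => (fP (K n)).1)
  (fun n => (fP (K n)).2)).
Qed.


Lemma proj_resolution0 M : has_proj_resolution M 0 <-> projective M.
Proof.
split=> [[P [d [e [projP P0 surj_e ex_e _]]]] | projM].
  have inj_e : injective e.
    apply: linear_eq0_inj => x /ex_e[y <-].
    by rewrite (P0 1%N _ y) // linear0.
  have [r rE] := factor_inj (f := idfun) inj_e surj_e.
  exact: (projective_retract (projP 0%N) rE).
have [Z Z0] := zero_module_exists R.
pose P n := if n is n'.+1 then Z else M.
have zero n : exists f : {linear P n.+1 -> P n}, forall x, f x = 0.
  by apply: linear_exists => a x y; rewrite scaler0 addr0.
pose d n := projT1 (cid (zero n)); have d0 n := projT2 (cid (zero n)).
exists P, d, idfun; split=> [[|n]|[|n] //| y | y | n y].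
- exact: projM.
- exact: zero_projective.
- by exists y.
- by split=> [y0 | [x <-]]; [exists 0; rewrite [RHS]y0 linear0 | exact: (d0 0%N x)].
split=> [_ | _]; last exact: (d0 n y).
by exists 0; rewrite linear0 [RHS]Z0.
Qed.

Lemma proj_resolution_cons L Q M (i : {linear L -> Q}) (p : {linear Q -> M}) n :
    short_exact i p -> projective Q ->
  has_proj_resolution L n -> has_proj_resolution M n.+1.
Proof.
move=> [inj_i ex surj_p] projQ [P [d [e [projP P0 surj_e ex_e ex_d]]]].
pose P' n := if n is n'.+1 then P n' else Q.
pose d' n : {linear P' n.+1 -> P' n} :=
  match n with 0 => i \o e | n'.+1 => d n' end.
exists P', d', p; split=> [[|k] //|[|k] //| // | y | [|k]].
- exact: projP.
- exact: P0.
- split=> [/ex[x <-] | [x <-]].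
    by have [z <-] := surj_e x; exists z.
  by apply/ex; exists (e x).
- move=> y; rewrite -[d' 1%N]/(d 0%N) -ex_e -[d' 0%N y]/(i (e y)).
  split=> [iey0 | ->]; last exact: linear0.
  by apply: inj_i; rewrite linear0.
exact: ex_d.
Qed.

Lemma proj_resolution_uncons M n : has_proj_resolution M n.+1 ->
  exists L Q (i : {linear L -> Q}) (p : {linear Q -> M}),
    [/\ short_exact i p, projective Q & has_proj_resolution L n].
Proof.
move=> [P [d [e [projP P0 surj_e ex_e ex_d]]]].
pose i := sub_incl (kernel_closed e).
have inj_i : injective i by exact: sub_incl_inj.
have [|e' e'E] := @factor_inj _ _ _ _ i (d 0%N) inj_i.
  by move=> x; apply/kernelP/ex_e; exists x.
exists (kernel e), (P 0%N), i, e; split=> //; first exact: short_exact_kernel.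
exists (fun n => P n.+1), (fun n => d n.+1), e'; split=> [k | k | y | y | k].
- exact: projP.
- by move=> nk; apply: P0.
- have /ex_e[x xE] : e (i y) = 0 by apply/kernelP; exists y.
  by exists x; apply: inj_i; rewrite e'E.
- rewrite -ex_d -e'E; split=> [-> | e0]; first exact: linear0.
  by apply: inj_i; rewrite e0 linear0.
exact: ex_d.
Qed.

Lemma proj_resolution_of_chain (c : proj_chain) n :
  projective (syzygy c n) -> has_proj_resolution (syzygy c 0) n.
Proof.
elim: n c => [|n IH] c projn; first exact/proj_resolution0.
apply: (proj_resolution_cons (pc_exact c 0) (@pc_projective c 0%N)).
exact: (IH (proj_chain_tail c)).
Qed.

Lemma proj_chain_of_resolution M n : has_proj_resolution M n ->
  exists2 c, syzygy c 0 = M & forall k, (n <= k)%N -> projective (syzygy c k).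
Proof.
elim: n M => [|n IH] M.
  move=> /proj_resolution0 projM; have [c c0] := zero_proj_chain.
  have [z zE] : exists z : {linear syzygy c 0 -> M}, forall x, z x = 0.
    by apply: linear_exists => a x y; rewrite scaler0 addr0.
  have ex : short_exact z (idfun : {linear M -> M}).
    split=> [x y _ | y | y]; [by rewrite (c0 0%N x) (c0 0%N y) | | by exists y].
    by split=> [y0 | [x <-]]; [exists 0; rewrite linear0 | rewrite zE].
  have [c' [E E']] := proj_chain_cons ex projM erefl.
  exists c' => // -[_|k _]; first by rewrite E.
  by rewrite E'; apply: zero_projective.
move=> /proj_resolution_uncons[L [Q [i [p [ex projQ /IH[c E projc]]]]]].
have [c' [E0 E']] := proj_chain_cons ex projQ E.
by exists c' => // -[//|k] nk; rewrite E'; apply: projc.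
Qed.

Lemma inj_chain_cons L Q M (i : {linear L -> Q}) (p : {linear Q -> M})
    (d : inj_chain) : short_exact i p -> injective_module Q -> cosyzygy d 0 = M ->
  exists d', cosyzygy d' 0 = L /\ forall n, cosyzygy d' n.+1 = cosyzygy d n.
Proof.
move=> ex injQ E; subst M.
pose N n := if n is n'.+1 then cosyzygy d n' else L.
pose I n := if n is n'.+1 then ic_inj d n' else Q.
pose i' n : {linear N n -> I n} :=
  match n with 0 => i | n'.+1 => ic_incl d n' end.
pose p' n : {linear I n -> N n.+1} :=
  match n with 0 => p | n'.+1 => ic_quot d n' end.
have ex' n : short_exact (i' n) (p' n) by case: n => // n; apply: ic_exact.
have inj' n : injective_module (I n) by case: n => // n; apply: ic_injective.
by exists (InjChain ex' inj').
Qed.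

Lemma zero_inj_chain : exists d, forall n, zero_module (cosyzygy d n).
Proof.
have [Z Z0] := zero_module_exists R.
have ex (n : nat) : short_exact (idfun : {linear Z -> Z}) (idfun : {linear Z -> Z}).
  split=> // [y | y]; last by exists y.
  by split=> [y0|_]; [exists 0; rewrite (Z0 y) | rewrite (Z0 y)].
by exists (@InjChain (fun=> Z) (fun=> Z) (fun=> idfun) (fun=> idfun) ex
  (fun _ => zero_injective Z0)).
Qed.

(** The cosyzygies are taken as cokernels, the first one N = E 0 / M, to which
    the rest of the resolution restricts. *)
Lemma inj_chain_of_resolution M n : has_inj_resolution M n ->
  exists2 d, cosyzygy d 0 = M & injective_module (cosyzygy d n).
Proof.
elim: n M => [|n IH] M [E [d [e [injE E0 inj_e ex_e ex_d]]]].
  have surj_e : surjective e.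
    by move=> y; apply/ex_e; apply: E0.
  have [d' d'0] := zero_inj_chain.
  have injM : injective_module M.
    have [r rE] := factor_inj (f := idfun) inj_e surj_e.
    have eK x : r (e x) = x by apply: inj_e; rewrite rE.
    move=> A B g f inj_g; have [h hE] := injE 0%N A B g (e \o f) inj_g.
    by exists (r \o h) => x /=; rewrite hE /= eK.
  have [z zE] : exists z : {linear M -> cosyzygy d' 0}, forall x, z x = 0.
    by apply: linear_exists => a x y; rewrite scaler0 addr0.
  have ex : short_exact (idfun : {linear M -> M}) z.
    split=> // y; last by exists 0; rewrite [LHS]d'0 [RHS]d'0.
    by split=> [_ | _]; [exists y | apply: d'0].
  have [d'' [E1 E2]] := inj_chain_cons ex injM erefl.
  by exists d'' => //; rewrite E1.
have [N [q ex]] := short_exact_cokernel inj_e; have [_ ex_q surj_q] := ex.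
have [|e' e'E] := @factor_surj _ _ _ _ q (d 0%N) surj_q.
  by move=> y /ex_q y0; apply/ex_e.
have [|d' E' injd'] := IH N.
  exists (fun n => E n.+1), (fun n => d n.+1), e'; split=> [k | k | | y | k].
  - exact: injE.
  - by move=> nk; apply: E0.
  - apply: linear_eq0_inj => x; have [y <-] := surj_q x.
    by rewrite e'E => /ex_e y0; apply/ex_q.
  - rewrite ex_d; split=> -[x <-]; first by exists (q x).
    by have [z <-] := surj_q x; exists z.
  exact: ex_d.
have [d'' [E1 E2]] := inj_chain_cons ex (injE 0%N) E'.
by exists d'' => //; rewrite E2.
Qed.

End Staircase.

Definition dual_chain (R R' : pzRingType) (op : {rmorphism R' -> R^c})
    (op' : {rmorphism R -> R'^c}) (opK : forall a, op (op' a) = a)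
    (op'K : forall a, op' (op a) = a) (c : proj_chain R) : inj_chain R' :=
  @InjChain R' (fun n => dual op (syzygy c n)) (fun n => dual op (pc_proj c n))
    (fun n => dual_map op (pc_cover c n)) (fun n => dual_map op (pc_incl c n))
    (fun n => dual_short_exact op (pc_exact c n))
    (fun n => dual_injective opK op'K (@pc_projective _ c n)).

(** * Semiprimary ideals *)

(** Nilpotency of J in a form that does not see the side of multiplication, as
    is needed to transfer it to the converse ring. *)
Definition products_vanish (R : pzRingType) (J : {pred R}) (t : nat) :=
  forall s : seq R, all (mem J) s -> size s = t -> \prod_(x <- s) x = 0.

(** The last field is the semisimplicity of R/J as a left module, expressed on
    the left ideals of R that contain J. Unlike the radical, defined through
    maximal left ideals, these properties pass to the converse ring for the
    same set J. *)
Record semiprimary_ideal (R : pzRingType) (J : {pred R}) : Prop := {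
  sp_left : submod_closed (J : {pred R^o});
  sp_right : forall x r, x \in J -> x * r \in J;
  sp_nil : exists t, products_vanish J t;
  sp_compl : forall I : {pred R^o}, submod_closed I -> {subset J <= I} ->
    exists C : {pred R^o}, [/\ submod_closed C,
      forall x, x \in I -> x \in C -> x \in J &
      exists i c, [/\ i \in I, c \in C & i + c = 1]] }.

Section SemiprimaryIdeal.
Variables (R : pzRingType) (J : {pred R}) (spJ : semiprimary_ideal J).
Implicit Types M N P Q L K : lmodType R.

Let clJ : submod_closed (J : {pred R^o}) := sp_left spJ.

Definition ideal_mul M : {pred M} := @ideal_smul R M J predT.

Lemma ideal_mulP M (y : M) :
  reflect (exists n (a : 'I_n -> R) (x : 'I_n -> M),
    (forall i, a i \in J) /\ y = \sum_i a i *: x i) (y \in @ideal_mul M).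
Proof.
apply: (iffP (asboolP _)) => -[n [a [x]]].
  by move=> [Ja _ ->]; exists n, a, x.
by move=> [Ja ->]; exists n, a, x; split.
Qed.

Lemma ideal_mul_closed M : submod_closed (@ideal_mul M).
Proof.
split=> [|c u v].
  by apply/ideal_mulP; exists 0%N, (fun=> 0), (fun=> 0); split=> [[]|] //; rewrite big_ord0.
move=> /ideal_mulP[n [a [x [Ja ->]]]] /ideal_mulP[m [b [y [Jb ->]]]].
apply/ideal_mulP; exists (n + m)%N.
exists (fun k : 'I_(n + m) => match fintype.split k with inl i => c * a i | inr j => b j end).
exists (fun k : 'I_(n + m) => match fintype.split k with inl i => x i | inr j => y j end).
split=> [k|]; first by case: (fintype.split k) => // i; apply: (submodZ clJ).
rewrite big_split_ord /= scaler_sumr; congr (_ + _); apply: eq_bigr => k _.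
  by rewrite (unsplitK (inl k : 'I_n + 'I_m)) scalerA.
by rewrite (unsplitK (inr k : 'I_n + 'I_m)).
Qed.

Lemma mem_ideal_mul M a (x : M) : a \in J -> a *: x \in @ideal_mul M.
Proof.
move=> Ja; apply/ideal_mulP; exists 1%N, (fun=> a), (fun=> x).
by rewrite big_ord1.
Qed.

Lemma ideal_mul_sub M (N : {pred M}) : submod_closed N ->
  (forall a x, a \in J -> a *: x \in N) -> {subset @ideal_mul M <= N}.
Proof.
move=> clN JN y /ideal_mulP[n [a [x [Ja ->]]]].
by apply: (submod_sum clN) => i; apply: JN.
Qed.

Lemma ideal_mul_killed M N (f : {linear M -> N}) x :
  (forall a y, a \in J -> a *: y = 0 :> N) -> x \in @ideal_mul M -> f x = 0.
Proof.
move=> JN Jx; apply/eqP.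
apply: (ideal_mul_sub (kernel_closed f) _ Jx) => a y Ja.
by rewrite unfold_in linearZ /= JN.
Qed.

(** The image of d^t lies in J^t L. The powers of J act here through products
    of scalars: a product of t - k elements of J kills the image of d^k. *)
Lemma ideal_mul_nilpotent L (d : {linear L -> L}) :
  (forall x, d x \in @ideal_mul L) -> exists t, forall x, iter t d x = 0.
Proof.
move=> Jd; have [t tP] := sp_nil spJ; exists t => x.
have key k : (k <= t)%N -> forall s x, all (mem J) s -> size s = (t - k)%N ->
    (\prod_(y <- s) y) *: iter k d x = 0.
  elim: k => [|k IH] ltkt s {}x Js sz.
    by rewrite tP ?scale0r // sz subn0.
  rewrite iterSr.
  have itD : linear (iter k d).
    move=> a u v; elim: k {IH ltkt sz} => //= k ->; exact: linearP.
  have [D DE] := linear_exists itD; rewrite -DE.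
  have /ideal_mulP[n [a [y [Ja ->]]]] := Jd x.
  rewrite linear_sum scaler_sumr big1 // => i _.
  rewrite linearZ /= scalerA DE.
  have := IH (ltnW ltkt) (rcons s (a i)) (y i).
  rewrite -cats1 big_cat big_seq1 all_cat /= Js Ja size_cat sz /=.
  by rewrite addn1 subnSK // => ->.
have := key t (leqnn t) nil x isT; rewrite subnn big_nil scale1r.
exact.
Qed.

(** Every module killed by J is injective among such modules. The hypothesis
    that G contains J B x 0 makes G a partial map on B/JB without forming the
    quotient. For the one-step extension, the ideal of definition I is
    complemented modulo J, and n is the value at i b where 1 = i + c. *)
Lemma semisimple_extend (B N : lmodType R) (G : {pred B * N}) : linear_graph G ->
  (forall a b, a \in J -> (a *: b, 0) \in G) ->
  exists h : {linear B -> N}, forall x y, (x, y) \in G -> h x = y.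
Proof.
move=> lgG JG; apply: extend_linear_graph => // G' lgG' sGG' b.
pose I : {pred R^o} := pred_of_Prop (fun a : R => exists y, (a *: b, y) \in G').
have clI : submod_closed I.
  split; first by apply/in_PropP; exists 0; rewrite scale0r (submod0 lgG'.1).
  move=> c u v /in_PropP[y Gy] /in_PropP[z Gz]; apply/in_PropP.
  exists (c *: y + z); rewrite scalerDl -scalerA.
  exact: linear_graphP.
have JI : {subset J <= I}.
  by move=> a Ja; apply/in_PropP; exists 0; apply/sGG'/JG.
have [C [clC IC [i [c [Ii Cc ic1]]]]] := sp_compl spJ clI JI.
have /in_PropP[n Gn] := Ii; exists n => a y Gy.
have Jac : a * c \in J.
  apply: IC; last exact: (submodZ clC).
  have -> : a * c = a - a * i by rewrite -[X in X - _](mulr1 a) -ic1 mulrDr addrC addKr.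
  apply: (submodB clI); last exact: (submodZ clI).
  by apply/in_PropP; exists y.
have := linear_graphP a lgG' Gn (sGG' _ (JG _ b Jac)).
rewrite scalerA -scalerDl -mulrDr ic1 mulr1 addr0.
exact: (linear_graph_fun lgG').
Qed.

(** The image of L in the semisimple module Q/JQ is a direct summand; lifting
    the projection along the projective Q gives r. The defect d = 1 - r i maps
    into JQ and replaces the kernel of a projective cover in all that follows,
    so that no minimal resolution has to be built. *)
Lemma approximate_retraction L Q (i : {linear L -> Q}) : projective Q ->
  exists r : {linear Q -> L}, forall l, i (l - r (i l)) \in @ideal_mul Q.
Proof.
move=> projQ; have clJQ := ideal_mul_closed Q.
(* L/L0 is the image of L in Q/JQ, and is killed by J. *)
have clL0 := preim_closed i clJQ; pose pi := quot_map clL0.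
pose G : {pred Q * quotient_module clL0} :=
  pred_of_Prop (fun z => exists l, z.1 - i l \in @ideal_mul Q /\ z.2 = pi l).
have lgG : linear_graph G.
  split; first split.
  - apply/in_PropP; exists 0; rewrite /= !linear0 addr0; split=> //; exact: (submod0 clJQ).
  - move=> c [u1 u2] [v1 v2] /in_PropP[l /= [Jl ->]] /in_PropP[l' /= [Jl' ->]].
    apply/in_PropP; exists (c *: l + l') => /=; split; last by rewrite linearP.
    by rewrite linearP opprD addrACA -scalerBr; apply: clJQ.2.
  move=> y /in_PropP[l /= [Jl ->]]; apply/quot_map_eq0; rewrite unfold_in.
  by rewrite -[i l](subKr 0); apply: (submodB clJQ) => //; apply: (submod0 clJQ).
have [h hG] : exists h : {linear Q -> quotient_module clL0},
    forall x y, (x, y) \in G -> h x = y.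
  apply: semisimple_extend => // a b Ja; apply/in_PropP; exists 0.
  by rewrite /= !linear0 addr0; split=> //; apply: mem_ideal_mul.
have [r rE] := projQ _ _ pi h (@quot_map_surj _ _ _ clL0).
exists r => l; suff : l - r (i l) \in (fun x => i x \in @ideal_mul Q) by [].
apply/(quot_map_eq0 clL0); rewrite linearB [X in _ - X]rE (hG _ (pi l)) ?subrr //.
by apply/in_PropP; exists l; rewrite /= subrr; split=> //; exact: (submod0 clJQ).
Qed.

(** If the defect d = 1 - r i maps L into JL, it is nilpotent, so r i = 1 - d
    is invertible, i splits and K is a direct summand of Q. *)
Lemma split_of_small_defect L Q K (i : {linear L -> Q}) (p : {linear Q -> K})
    (r : {linear Q -> L}) : short_exact i p -> projective Q ->
  (forall l, l - r (i l) \in @ideal_mul L) -> projective K.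
Proof.
move=> [inj_i ex surj_p] projQ small.
have [d dE] : exists d : {linear L -> L}, forall l, d l = l - r (i l).
  apply: linear_exists => a x y.
  by rewrite !linearP scalerDr addrACA.
have [|t dt] := @ideal_mul_nilpotent L d; first by move=> x; rewrite dE.
have [s sE] : exists s : {linear Q -> L}, forall l, l - s (i l) = iter t d l.
  elim: t {dt} => [|t [s sE]].
    have [s sE] : exists s : {linear Q -> L}, s =1 fun=> 0.
      by apply: linear_exists => a x y; rewrite scaler0 addr0.
    by exists s => l; rewrite sE subr0.
  have [s' s'E] : exists s' : {linear Q -> L}, s' =1 fun q => r q + d (s q).
    by apply: linear_exists => a x y; rewrite !linearP scalerDr addrACA.
  by exists s' => l; rewrite iterS -sE s'E linearB (dE l) opprD addrA.
have sK l : s (i l) = l.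
  by apply/eqP; rewrite eq_sym -subr_eq0 sE dt.
have [u uE] : exists u : {linear Q -> Q}, forall q, u q = q - i (s q).
  apply: linear_exists => a x y.
  by rewrite !linearP scalerDr addrACA.
have [|v vE] := @factor_surj _ _ _ _ p u surj_p.
  by move=> _ /ex[l <-]; rewrite uE sK subrr.
apply: (@projective_retract _ K Q v p) => // x; have [q <-] := surj_p x.
rewrite vE uE linearB.
have -> : p (i (s q)) = 0 by apply/ex; exists (s q).
by rewrite subr0.
Qed.

End SemiprimaryIdeal.

(** * Local idempotents and the converse ring *)

Section JacobsonIdeal.
Variable R : pzRingType.
Local Notation J := (jacobson R).

Lemma jacobson_closed : submod_closed (J : {pred R^o}).
Proof. exact: radical_submod_closed. Qed.

Lemma jacobson_mull (a x : R) : x \in J -> a * x \in J.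
Proof. exact: (@submodZ _ _ _ jacobson_closed a x). Qed.

Lemma jacobsonD (x y : R) : x \in J -> y \in J -> x + y \in J.
Proof. exact: (@submodD _ _ _ jacobson_closed x y). Qed.

Lemma jacobsonB (x y : R) : x \in J -> y \in J -> x - y \in J.
Proof. exact: (@submodB _ _ _ jacobson_closed x y). Qed.

(** The complement is found in the ring R/J and pulled back. *)
Lemma jacobson_complement : semisimple_module (residue_ring R)^o ->
  forall I : {pred R^o}, submod_closed I -> {subset J <= I} ->
    exists C : {pred R^o}, [/\ submod_closed C,
      forall x, x \in I -> x \in C -> x \in J &
      exists i c, [/\ i \in I, c \in C & i + c = 1]].
Proof.
move=> ss I clI JI; have clJ := jacobson_closed.
pose cl (u : R) : residue_ring R := \pi_{ideal_quot (radical R^o)} u.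
have clE (u v : R) : (cl u == cl v) = (u - v \in J).
  exact: esym (@Quotient.idealrBE _ (radical R^o) u v).
have clD (u v : R) : cl (u + v) = cl u + cl v by rewrite /cl Quotient.pi_add.
have clM (u v : R) : cl (u * v) = cl u * cl v := esym (residue_mulE u v).
have cl_surj (z : residue_ring R) : exists u, z = cl u.
  by exists (repr z); rewrite /cl reprK.
have cl0 : cl 0 = 0 by apply: (addrI (cl 0)); rewrite -clD !addr0.
pose N : {pred (residue_ring R)^o} :=
  pred_of_Prop (fun z : residue_ring R => exists2 u, u \in I & z = cl u).
have clN : submod_closed N.
  split; first by apply/in_PropP; exists 0; rewrite ?cl0 //; apply: (submod0 clI).
  move=> a _ _ /in_PropP[u Iu ->] /in_PropP[v Iv ->]; apply/in_PropP.
  have [b ->] := cl_surj a; exists (b * u + v); first exact: clI.2.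
  by rewrite clD clM.
have [N' clN' [NN' tot]] := ss N clN.
exists (fun x : R => cl x \in N'); split.
- split; first by rewrite unfold_in cl0 (submod0 clN').
  move=> a u v N'u N'v; rewrite unfold_in.
  by rewrite -[a *: u]/(a * u) clD clM; apply: clN'.2.
- move=> x Ix N'x; have /eqP : cl x = 0.
    by apply: NN' => //; apply/in_PropP; exists x.
  by rewrite -cl0 clE subr0.
have [_ [z [/in_PropP[u Iu ->] N'z one]]] := tot (cl 1).
have [c zE] := cl_surj z; exists (1 - c), c; split; last by rewrite subrK.
  have Juc : 1 - (u + c) \in J by rewrite -clE clD -zE; apply/eqP.
  have -> : 1 - c = u + (1 - (u + c)) by rewrite opprD addrCA addNKr.
  by apply: (submodD clI) => //; apply: JI.
by rewrite unfold_in -zE.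
Qed.

Lemma semiprimary_jacobson : semiprimary R -> semiprimary_ideal J.
Proof.
move=> [ss [t Jt]]; split; [exact: jacobson_closed | exact: jacobson_mulr | |
  exact: jacobson_complement].
exists t => s Js sz; apply: Jt; rewrite -{}sz.
elim: s Js => [|x s IH] /=; first by rewrite big_nil.
move=> /andP[Jx Js]; rewrite big_cons.
apply/asboolP; exists 1%N, (fun=> x), (fun=> \prod_(y <- s) y).
by split=> [_ // | _ | ]; [exact: IH | rewrite big_ord1].
Qed.

End JacobsonIdeal.

Section MaximalSubmodules.
Variable R : pzRingType.

Lemma transporter_closed (M : lmodType R) (N : {pred M}) (x : M) :
  submod_closed N -> submod_closed (fun a : R^o => (a : R) *: x \in N : bool).
Proof.
move=> clN; split=> [|a u v Nu Nv]; rewrite unfold_in ?scale0r ?(submod0 clN) //.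
by rewrite scalerDl -scalerA; apply: clN.2.
Qed.

(** The quotient by this left ideal is generated by the class of x in the
    simple module M/N. *)
Lemma transporter_maximal (M : lmodType R) (N : {pred M}) (x : M) :
  maximal_submodule N -> x \notin N ->
  maximal_submodule (fun a : R^o => (a : R) *: x \in N : bool).
Proof.
move=> [clN _ maxN] Nx; split; first exact: transporter_closed.
  by exists 1; rewrite unfold_in scale1r.
move=> I clI sI; have [sI' | /existsNP[b /not_implyP[Ib /negP nb]]] :=
  pselect {subset I <= fun a : R^o => (a : R) *: x \in N : bool}.
  by left.
right=> a.
pose N' := pred_of_Prop (fun y : M => exists n (c : R), [/\ n \in N, c \in I & y = n + c *: x]).
have clN' : submod_closed N'.
  split; first by apply/in_PropP; exists 0, 0; rewrite scale0r addr0
    (submod0 clN) (submod0 clI).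
  move=> d _ _ /in_PropP[n [c [Nn Ic ->]]] /in_PropP[n' [c' [Nn' Ic' ->]]].
  apply/in_PropP; exists (d *: n + n'), (d * c + c'); split; first exact: clN.2.
    exact: clI.2.
  by rewrite scalerDr addrACA scalerA -scalerDl.
have sN' : {subset N <= N'}.
  move=> n Nn; apply/in_PropP; exists n, 0.
  by rewrite scale0r addr0 (submod0 clI).
have [sN'N | /(_ x)/in_PropP[n [c [Nn Ic xE]]]] := maxN _ clN' sN'.
  case/negP: nb; rewrite unfold_in; apply: sN'N; apply/in_PropP.
  by exists 0, b; rewrite add0r (submod0 clN).
have I1c : 1 - c \in I.
  by apply: sI; rewrite unfold_in scalerBl scale1r {1}xE addrK.
rewrite -[a]mulr1 -(subrK c 1); apply: (submodZ clI (a : R)).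
exact: (submodD clI).
Qed.

(** For x outside a maximal submodule N, the elements sending x into N form a
    maximal left ideal, which contains J. *)
Lemma ideal_mul_radical (M : lmodType R) :
  {subset @ideal_mul R (jacobson R) M <= radical M}.
Proof.
apply: ideal_mul_sub; first exact: radical_submod_closed.
move=> a x Ja; apply/radicalP => N maxN.
have [Nx | nNx] := boolP (x \in N); first by case: maxN => clN _ _; apply: submodZ.
by move/radicalP: Ja => /(_ _ (transporter_maximal maxN nNx)).
Qed.

End MaximalSubmodules.

(** One step of Newton's method for X^2 - X, which squares the defect z. *)
Lemma newton_idempotent (R : pzRingType) (c z : R) : c * c = c + z ->
  let c' := c + (1 - c - c) * z in c' * c' - c' = z * z * (z *+ 4 - 1 *+ 3).
Proof.
move=> ccE /=; set s := 1 - c - c.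
have cz : c * z = z * c.
  by rewrite -(addKr c z) -ccE mulrDr mulrDl mulrN mulNr mulrA.
have cs : c * s = s * c by rewrite /s !mulrBr !mulrBl mulr1 mul1r.
have sz : s * z = z * s by rewrite /s !mulrBr !mulrBl mulr1 mul1r cz.
have sc : s * c = - (c + z + z).
  by rewrite /s !mulrBl mul1r ccE !opprD !addrA subrr sub0r (addrC (- z)).
have ss : s * s = 1 + z *+ 4.
  rewrite {2}/s !mulrBr mulr1 sc opprK -!(addrA c z z) /s.
  rewrite -[1 - c - c]addrA -opprD -addrA (addrACA c _ c) [LHS]addrA subrK.
  by rewrite -!mulr2n -mulrnA.
have szc : s * z * c = - (c * z + z * z *+ 2).
  by rewrite -mulrA -cz mulrA sc mulNr !mulrDl mulr2n addrA.
have csz : c * (s * z) = s * z * c by rewrite mulrA cs -!mulrA cz.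
have szsz : s * z * (s * z) = z * z + z * z * z *+ 4.
  by rewrite mulrA -(mulrA s z s) -sz mulrA ss !mulrDl mul1r !mulrS mulr0n addr0.
rewrite mulrDl !mulrDr csz szc szsz ccE.
have -> : s * z = z - (c * z + c * z) by rewrite /s !mulrBl mul1r opprD addrA.
set p := c * z; set q := z * z; set r := q * z.
rewrite mulrN mulrnAr mulr1.
have -> : r + (r + (r + r)) = r *+ 4 by rewrite !mulrS mulr0n addr0.
have -> : c + z - (p + q *+ 2) + (- (p + q *+ 2) + (q + r *+ 4)) =
   (c + (z - (p + p))) + (r *+ 4 - q *+ 3).
  move: (r *+ 4) => w.
  rewrite [in RHS]addrA -!addrA; congr (_ + (_ + _)).
  rewrite !opprD -!addrA; congr (- p + _).
  rewrite !(addrCA (- q) (- p)); congr (- p + _); rewrite addKr.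
  by rewrite [RHS]addrC -!addrA.
by rewrite addrAC subrr add0r.
Qed.

Section Idempotents.
Variables (R : pzRingType) (spJ : semiprimary_ideal (jacobson R)).
Local Notation J := (jacobson R).

Lemma lift_idempotent (c : R) : c * c - c \in J ->
  exists e, e * e = e /\ e - c \in J.
Proof.
have [t tP] := sp_nil spJ.
have [k tk] : exists k, (t <= 2 ^ k)%N by exists t; apply/ltnW/ltn_expl.
move=> Jc; have : (c * c - c) ^+ (2 ^ k) = 0.
  rewrite -(subnKC tk) exprD -[X in X * _](_ : \prod_(x <- nseq t (c * c - c)) x = _).
    by rewrite tP ?mul0r ?size_nseq //; apply/allP => x /nseqP[-> _].
  by rewrite big_nseq; elim: t {tP tk} => [|t IHt]; rewrite ?expr0 //= IHt exprS.
(* A Newton step squares the defect up to a factor, so it lowers k by one. *)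
elim: k c Jc {t tP tk} => [|k IH] c Jc; set z := c * c - c => z0.
  by exists c; rewrite subrr (submod0 (sp_left spJ)); split=> //; apply/eqP;
    rewrite -subr_eq0 -/z -[z]expr1 z0.
pose c' := c + (1 - c - c) * z.
have ccE : c * c = c + z by rewrite addrC subrK.
have zE : c' * c' - c' = z * z * (z *+ 4 - 1 *+ 3) by exact: newton_idempotent.
have [|| e [ee Jec']] := IH c'.
- by rewrite zE; apply: jacobson_mulr; apply: jacobson_mulr.
- have zcomm : GRing.comm (z * z) (z *+ 4 - 1 *+ 3).
    apply: commrB; first by apply: commrMn; apply: commr_sym; apply: commrM.
    by apply: commrMn; apply: commr1.
  by rewrite zE exprMn_comm // -expr2 -exprM -expnS z0 mul0r.
exists e; split=> //.
have -> : e - c = (e - c') + (1 - c - c) * z by rewrite /c' opprD addrA subrK.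
by apply: jacobsonD => //; apply: jacobson_mull.
Qed.

(** For idempotent e the displayed left ideal is the kernel of R -> Re/Je, so
    its maximality says that Re/Je is simple. *)
Definition local_idempotent (e : R) :=
  e * e = e /\ maximal_submodule (fun x : R^o => (x : R) * e \in J : bool).

(** A complement of N modulo J yields 1 = n + c with N c inside J, so c is
    idempotent modulo J; lift it. *)
Lemma maximal_local_idempotent (N : {pred R^o}) : maximal_submodule N ->
  exists2 e, local_idempotent e & forall x : R, (x * e \in J) = (x \in N).
Proof.
move=> maxN; have [clN properN _] := maxN.
have JN : {subset J <= N} by move=> x /radicalP; apply.
have [C [clC NC [n [c [Nn Cc nc1]]]]] := sp_compl spJ clN JN.
have xc (x : R) : x * c = x - x * n by rewrite -[X in X - _](mulr1 x) -nc1 mulrDr addrC addKr.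
have xcJ (x : R) : x \in N -> x * c \in J.
  move=> Nx; apply: NC; last exact: (submodZ clC).
  by rewrite xc; apply: (submodB clN) => //; apply: (submodZ clN).
have [|e [ee Jec]] := @lift_idempotent c.
  have -> : c * c - c = - (n * c).
    by rewrite -[X in _ - X]mul1r -nc1 mulrDl opprD addrC subrK.
  by rewrite -sub0r jacobsonB ?(submod0 (sp_left spJ)) ?xcJ.
have eN (x : R) : (x * e \in J) = (x \in N).
  have xec : x * e - x * c \in J by rewrite -mulrBr; apply: jacobson_mull.
  apply/idP/idP => [Jxe | Nx]; last first.
    by rewrite -(subrK (x * c) (x * e)); apply: jacobsonD => //; apply: xcJ.
  have Jxc : x * c \in J by rewrite -(subKr (x * e) (x * c)); apply: jacobsonB.
  rewrite -[x]mulr1 -nc1 mulrDr; apply: (submodD clN); first exact: (submodZ clN).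
  exact: JN.
exists e => //; split=> //.
have -> : (fun x : R^o => (x : R) * e \in J : bool) = N by apply/funext => x; rewrite eN.
exact: maxN.
Qed.

(** The left ideal I generated by J and all local idempotents is everything.
    Otherwise its complement contains an element outside J, which a maximal
    left ideal N misses; the transporter of that element into N is a maximal
    left ideal containing I, and its own local idempotent, an element of I,
    would then lie in J. Membership of 1 involves only finitely many
    idempotents. *)
Lemma local_idempotents_span : exists m (e a : 'I_m -> R),
  (forall j, local_idempotent (e j)) /\ 1 - \sum_j a j * e j \in J.
Proof.
have clJ := sp_left spJ.
pose I : {pred R^o} := pred_of_Prop (fun x : R => exists m (e a : 'I_m -> R),
  (forall j, local_idempotent (e j)) /\ x - \sum_j a j * e j \in J).
suff /in_PropP : (1 : R^o) \in I by [].
have clI : submod_closed I.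
  split; first by apply/in_PropP; exists 0%N, (fun=> 0), (fun=> 0);
    split=> [[]//|]; rewrite big_ord0 subr0 (submod0 clJ).
  move=> c x y /in_PropP[m [e [a [le Jx]]]] /in_PropP[n [f [b [lf Jy]]]].
  apply/in_PropP; exists (m + n)%N.
  exists (fun k : 'I_(m + n) => match fintype.split k with inl i => e i | inr j => f j end).
  exists (fun k : 'I_(m + n) => match fintype.split k with inl i => c * a i | inr j => b j end).
  split=> [k|]; first by case: (fintype.split k).
  rewrite big_split_ord /=.
  have -> : \sum_(i < m)
      match fintype.split (lshift n i) with inl i => c * a i | inr j => b j end *
      match fintype.split (lshift n i) with inl i => e i | inr j => f j end =
      c * \sum_i a i * e i.
    rewrite mulr_sumr; apply: eq_bigr => i _.
    by rewrite (unsplitK (inl i : 'I_m + 'I_n)) mulrA.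
  have -> : \sum_(i < n)
      match fintype.split (rshift m i) with inl i => c * a i | inr j => b j end *
      match fintype.split (rshift m i) with inl i => e i | inr j => f j end =
      \sum_i b i * f i.
    by apply: eq_bigr => i _; rewrite (unsplitK (inr i : 'I_m + 'I_n)).
  by rewrite opprD addrACA -mulrBr; apply: jacobsonD => //; apply: jacobson_mull.
have JI : {subset J <= I}.
  move=> x Jx; apply/in_PropP; exists 0%N, (fun=> 0), (fun=> 0).
  by split=> [[]//|]; rewrite big_ord0 subr0.
have [C [clC IC [i [c [Ii Cc ic1]]]]] := sp_compl spJ clI JI.
apply: contrapT => nI1.
have nJc : c \notin J.
  apply/negP => Jc; apply: nI1; rewrite -ic1.
  by apply: (submodD clI) => //; apply: JI.
have [N maxN nNc] : exists2 N : {pred R^o}, maximal_submodule N & c \notin N.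
  apply: contrapT => noN; case/negP: nJc; apply/radicalP => N maxN.
  by apply/negP => /negP nNc; apply: noN; exists N.
have [e le eN] := maximal_local_idempotent (transporter_maximal maxN nNc).
have [ee [_ [x nx] _]] := le.
have Ie : (e : R^o) \in I.
  apply/in_PropP; exists 1%N, (fun=> e), (fun=> 1); split=> //.
  by rewrite big_ord1 mul1r subrr (submod0 clJ).
have Jec : e * c \in J.
  apply: IC; last exact: (submodZ clC).
  have -> : e * c = e - e * i by rewrite -[X in X - _](mulr1 e) -ic1 mulrDr addrC addKr.
  by apply: (submodB clI) => //; apply: (submodZ clI).
have Je : e \in J.
  rewrite -ee eN unfold_in.
  by have /radicalP := Jec; apply.
by case/negP: nx; rewrite unfold_in; apply: jacobson_mull.
Qed.

(** The right module (xR + J)/J is simple or zero. *)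
Definition right_minimal (x : R) :=
  forall b, x * b \notin J -> exists c, x * b * c - x \in J.

(** Right multiplication by b is injective on the simple left module Re/Je
    when eb is not in J; as R/J is semisimple it has a retraction, which is
    again a right multiplication. *)
Lemma local_right_minimal e : local_idempotent e -> right_minimal e.
Proof.
move=> [ee [clNe [x0 nx0] maxNe]] b nJeb; have clJ := sp_left spJ.
have ebJ (x : R) : x * (e * b) \in J -> x * e \in J.
  pose I : {pred R^o} := fun x : R => x * (e * b) \in J.
  have clI : submod_closed I.
    split=> [|a u v Iu Iv]; rewrite unfold_in /I ?mul0r ?(submod0 clJ) //.
    rewrite -[a *: u]/(a * u) mulrDl -mulrA.
    by apply: jacobsonD => //; apply: jacobson_mull.
  have sI : {subset (fun x : R^o => (x : R) * e \in J : bool) <= I}.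
    by move=> y Jye; rewrite unfold_in /I mulrA; apply: jacobson_mulr.
  have [sI' | /(_ 1)] := maxNe _ clI sI; first exact: sI'.
  by rewrite unfold_in /I mul1r (negPf nJeb).
pose I : {pred R^o} := pred_of_Prop (fun x : R => exists a, x - a * (e * b) \in J).
have clI : submod_closed I.
  split; first by apply/in_PropP; exists 0; rewrite mul0r subr0 (submod0 clJ).
  move=> d u v /in_PropP[a Ju] /in_PropP[a' Jv]; apply/in_PropP.
  exists (d * a + a'); rewrite mulrDl opprD addrACA -[d *: u]/(d * u) -mulrA -mulrBr.
  by apply: jacobsonD => //; apply: jacobson_mull.
have JI : {subset J <= I}.
  by move=> x Jx; apply/in_PropP; exists 0; rewrite mul0r subr0.
have [C [clC IC [i [c [Ii Cc ic1]]]]] := sp_compl spJ clI JI.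
have Iseb : e * b \in I by apply/in_PropP; exists 1; rewrite mul1r subrr (submod0 clJ).
have Jebc : e * b * c \in J.
  apply: IC; last exact: (submodZ clC).
  have -> : e * b * c = e * b - e * b * i.
    by rewrite -[X in X - _](mulr1 (e * b)) -ic1 mulrDr addrC addKr.
  by apply: (submodB clI) => //; apply: (submodZ clI).
have /in_PropP[a Jia] := Ii.
exists (a * e); rewrite -(opprB e) -sub0r; apply: jacobsonB; first exact: (submod0 clJ).
have -> : e - e * b * (a * e) = (1 - e * b * a) * e by rewrite mulrBl mul1r !mulrA.
apply: ebJ; rewrite mulrBl mul1r -(mulrA (e * b) a).
have -> : e * b - e * b * (a * (e * b)) =
    e * b * c * 1 + e * b * (i - a * (e * b)).
  by rewrite mulr1 mulrBr addrA -mulrDr [c + i]addrC ic1 mulr1.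
by rewrite mulr1; apply: jacobsonD => //; apply: jacobson_mull.
Qed.

Lemma right_minimal_mull a x : right_minimal x -> right_minimal (a * x).
Proof.
move=> rx b nJ; have [|c Jc] := rx b.
  by apply: contra nJ => Jxb; rewrite -mulrA jacobson_mull.
by exists c; rewrite -!mulrA -mulrBr mulrA; apply: jacobson_mull.
Qed.

(** Writing 1 modulo J as a sum of a_j e_j exhibits R/J as a finite sum of
    simple right modules, since a left multiple of a right minimal element is
    right minimal. A complement of a right ideal I is then assembled greedily,
    adding x_j R whenever x_j is not already in the sum. *)
Lemma semiprimary_converse : semiprimary_ideal (J : {pred R^c}).
Proof.
have clJ := sp_left spJ.
have clJc : submod_closed (J : {pred (R^c)^o}).
  split=> [|a u v Ju Jv]; first exact: (submod0 clJ).
  by apply: jacobsonD => //; apply: jacobson_mulr.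
split=> //.
- by move=> x r Jx; apply: (jacobson_mull (r : R) Jx).
- have [t tP] := sp_nil spJ; exists t => s Js sz.
  have -> : \prod_(x <- s) x = \prod_(x <- rev s) (x : R).
    elim: s {Js sz} => [|x s IH]; first by rewrite !big_nil.
    by rewrite big_cons rev_cons -cats1 big_cat big_seq1 IH.
  by apply: tP; rewrite ?size_rev ?all_rev.
move=> I clI JI.
have [m [e [a [le J1]]]] := local_idempotents_span.
pose x j : R := a j * e j.
have rx j : right_minimal (x j) by apply/right_minimal_mull/local_right_minimal.
have IMr (y b : R) : y \in I -> y * b \in I by apply: (@submodZ R^c (R^c)^o I clI b y).
suff [C [clC JC IC xC]] : exists C : {pred (R^c)^o}, [/\ submod_closed C,
    {subset J <= C}, forall y, y \in I -> y \in C -> y \in J &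
    forall j, exists i c : R, [/\ i \in I, c \in C & i + c = x j]].
  exists C; split=> //.
  have [f /choice[g fg]] := choice xC.
  exists (\sum_j f j), (1 - \sum_j f j); split; last by rewrite addrC subrK.
    by apply: (submod_sum clI) => j; case: (fg j).
  have -> : 1 - \sum_j f j = (1 - \sum_j x j) + \sum_j g j.
    have -> : \sum_j x j = \sum_j f j + \sum_j g j.
      by rewrite -big_split; apply: eq_bigr => j _; case: (fg j).
    by rewrite opprD addrA subrK.
  apply: (submodD clC); first exact: JC.
  by apply: (submod_sum clC) => j; case: (fg j).
suff [C [clC JC IC xC]] : exists C : {pred (R^c)^o}, [/\ submod_closed C,
    {subset J <= C}, forall y, y \in I -> y \in C -> y \in J &
    forall j, j \in enum 'I_m -> exists i c : R, [/\ i \in I, c \in C & i + c = x j]].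
  by exists C; split=> // j; apply: xC; rewrite mem_enum.
elim: (enum 'I_m) => [|j s [C [clC JC IC sC]]].
  by exists J; split.
have [[i [c [Ii Cc icx]]] | nxj] :=
    pselect (exists i c : R, [/\ i \in I, c \in C & i + c = x j]).
  exists C; split=> // k; rewrite inE => /orP[/eqP -> | /sC //].
  by exists i, c.
pose C' : {pred (R^c)^o} := pred_of_Prop (fun y : R =>
  exists c b : R, c \in C /\ y = c + x j * b).
have CC' : {subset C <= C'}.
  by move=> y Cy; apply/in_PropP; exists y, 0; rewrite mulr0 addr0.
exists C'; split.
- split; first exact/CC'/(submod0 clC).
  move=> d _ _ /in_PropP[c [b [Cc ->]]] /in_PropP[c' [b' [Cc' ->]]].
  apply/in_PropP; exists (c * d + c'), (b * d + b'); split; first exact: clC.2.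
  by rewrite -[_ *: _]/((c + x j * b) * d) mulrDl addrACA mulrDr mulrA.
- by move=> y /JC/CC'.
- move=> y Iy /in_PropP[c [b [Cc yE]]].
  (* x_j is minimal and not in I + C, so x_j b is in I + C only if it is in J. *)
  have [Jxb | nJxb] := boolP (x j * b \in J).
    by apply: IC => //; rewrite yE; apply: (submodD clC) => //; apply: JC.
  have [d Jd] := rx j b nJxb; case: nxj.
  exists ((y : R) * d - (x j * b * d - x j)), (- (c * d)); split.
  - by apply: (submodB clI); [apply: IMr | apply: JI].
  - rewrite -sub0r; apply: (submodB clC); first exact: (submod0 clC).
    exact: (@submodZ R^c (R^c)^o C clC d c).
  by rewrite yE mulrDl opprB addrC [LHS]addrA addKr addrCA subrr addr0.
move=> k; rewrite inE => /orP[/eqP -> | /sC [i [c [Ii Cc icx]]]].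
  exists 0, (x j); split; [exact: (submod0 clI) | | by rewrite add0r].
  by apply/in_PropP; exists 0, 1; rewrite mulr1 add0r; split=> //; apply: (submod0 clC).
by exists i, c; split=> //; apply: CC'.
Qed.

End Idempotents.

(** * The indecomposable projective module Re *)

Section LocalProjective.
Variables (R : pzRingType) (spJ : semiprimary_ideal (jacobson R)) (e : R).
Hypothesis le : local_idempotent e.
Local Notation J := (jacobson R).

Let clJ := sp_left spJ.
Let ee : e * e = e := le.1.

Lemma principal_closed :
  submod_closed (fun x : R^o => (x : R) * e == x :> R : bool).
Proof.
split=> [|a u v /eqP uE /eqP vE]; rewrite unfold_in ?mul0r //.
by rewrite -[a *: u]/(a * u) mulrDl -mulrA uE vE.
Qed.

(** The module Re, as the set of ring elements fixed by right multiplication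
    by e. *)
Definition principal : lmodType R := sub_module principal_closed.

Definition pval (x : principal) : R := sub_incl principal_closed x.

Lemma pval_e x : pval x * e = pval x.
Proof. exact/eqP/(sub_inclP x). Qed.

Lemma pvalZ a x : pval (a *: x) = a * pval x.
Proof. by rewrite /pval linearZ. Qed.

Lemma pgen_in : (e : R^o) \in submodule_of principal_closed.
Proof. exact/eqP. Qed.

Definition pgen : principal := Sub (e : R^o) pgen_in.

Lemma pgenE : pval pgen = e. Proof. by []. Qed.

Lemma pval_inj : injective pval. Proof. exact: sub_incl_inj. Qed.

Lemma principal_gen (x : principal) : x = pval x *: pgen.
Proof. by apply: pval_inj; rewrite pvalZ pgenE pval_e. Qed.

Lemma principal_projective : projective principal.
Proof.
have [r rE] : exists r : {linear R^o -> principal}, forall x : R, r x = x *: pgen.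
  by apply: linear_exists => a x y; rewrite scalerDl scalerA.
apply: (projective_retract (s := sub_incl principal_closed) (r := r)) => [|x].
  exact: regular_projective.
by rewrite rE [RHS]principal_gen.
Qed.

(** Maximality of the left ideal attached to e, as a criterion for a left
    ideal to be the whole ring. *)
Lemma local_idempotent_test (I : {pred R^o}) : submod_closed I ->
    (forall a : R, a * e \in J -> a \in I) ->
  (exists2 x : R, x \in I & x * e \notin J) -> forall a, a \in I.
Proof.
move=> clI sI [x Ix nJ]; have [_ [_ _ maxN]] := le.
have [sI' | //] := maxN I clI sI.
by move: nJ; have := sI' _ Ix; rewrite unfold_in => ->.
Qed.

Lemma local_idempotent_notin : e \notin J.
Proof.
have [_ [_ [x nx] _]] := le; apply: contra nx => Je.
by rewrite unfold_in; apply: jacobson_mull.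
Qed.

(** Re is local: y generates it modulo J, say e = a y + j e with j in J, and
    iterating this equation pushes the error into a power of j, which
    vanishes. *)
Lemma principal_generator (y : principal) : pval y \notin J ->
  exists a, a *: y = pgen.
Proof.
move=> nJy.
pose I : {pred R^o} := pred_of_Prop (fun x : R => exists a, x * e - a * pval y \in J).
have /(_ 1)/in_PropP[a Ja] : forall x, x \in I.
  apply: local_idempotent_test; first split.
  - by apply/in_PropP; exists 0; rewrite !mul0r subr0 (submod0 clJ).
  - move=> c u v /in_PropP[a Ja] /in_PropP[b Jb]; apply/in_PropP.
    exists (c * a + b); rewrite -[c *: u]/(c * u) !mulrDl opprD addrACA -!mulrA -mulrBr.
    by apply: jacobsonD => //; apply: jacobson_mull.
  - by move=> a Ja; apply/in_PropP; exists 0; rewrite mul0r subr0.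
  exists (pval y); last by rewrite pval_e.
  by apply/in_PropP; exists 1; rewrite mul1r pval_e subrr (submod0 clJ).
set j := 1 * e - a * pval y in Ja.
have eE : e = a * pval y + j * e.
  by rewrite /j mulrBl mul1r ee -mulrA pval_e addrC subrK.
have approx n : exists b, e = b * pval y + j ^+ n * e.
  elim: n => [|n [b IH]]; first by exists 0; rewrite mul0r add0r mul1r.
  exists (b + j ^+ n * a); apply: (etrans IH); rewrite exprSr mulrDl -addrA; congr (_ + _).
  by rewrite -!mulrA -mulrDr; congr (_ * _).
have [t tP] := sp_nil spJ; have [b bE] := approx t.
exists b; apply: pval_inj; rewrite pvalZ pgenE.
suff jt : j ^+ t = 0 by rewrite [RHS]bE jt mul0r addr0.
have := tP (nseq t j) _ (size_nseq t j).
rewrite big_nseq (_ : iter t _ _ = j ^+ t) => [-> //|].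
  by apply/allP => x /nseqP[-> _].
by elim: t {tP bE} => [|t IH]; rewrite ?expr0 //= IH exprS.
Qed.

Lemma pval_radical x : (x \in radical principal) = (pval x \in J).
Proof.
have clM := preim_closed (sub_incl principal_closed) clJ.
apply/idP/idP => [/radicalP radx | Jx]; last first.
  by apply: ideal_mul_radical; rewrite (principal_gen x); apply: mem_ideal_mul.
apply: (radx (fun y => pval y \in J : bool)); split=> //.
  by exists pgen; rewrite unfold_in pgenE local_idempotent_notin.
move=> N clN sN.
have [sN' | /existsNP[y /not_implyP[Ny /negP nJy]]] :=
  pselect {subset N <= fun y => pval y \in J : bool}; first by left.
right=> z; have [a aE] := principal_generator nJy.
by rewrite (principal_gen z) -aE; do 2!apply: (submodZ clN).
Qed.

Lemma principal_indecomposable : indecomposable principal.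
Proof.
split=> [P0 | N N' clN clN' [NN' tot]].
  have := local_idempotent_notin.
  by rewrite -pgenE (P0 pgen) /pval linear0 (submod0 clJ).
have full (K : {pred principal}) y : submod_closed K -> y \in K ->
    pval y \notin J -> forall z, z \in K.
  move=> clK Ky /principal_generator[a aE] z.
  by rewrite (principal_gen z) -aE; do 2!apply: (submodZ clK).
have [y [z [Ny N'z yz]]] := tot pgen.
have [Jy | nJy] := boolP (pval y \in J); last first.
  by right=> x N'x; apply: NN' => //; exact: (full N y).
have [Jz | nJz] := boolP (pval z \in J); last first.
  by left=> x Nx; apply: NN' => //; exact: (full N' z).
case/negP: local_idempotent_notin; rewrite -pgenE yz /pval linearD.
exact: jacobsonD.
Qed.

Definition simple_top := top principal.
Definition top_map : {linear principal -> simple_top} :=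
  quot_map (radical_submod_closed principal).

Lemma top_killed a (s : simple_top) : a \in J -> a *: s = 0.
Proof.
move=> Ja; have [x <-] := quot_map_surj s; rewrite -linearZ.
by apply/quot_map_eq0/ideal_mul_radical/mem_ideal_mul.
Qed.

Lemma top_map_eq0 x : top_map x = 0 <-> pval x \in J.
Proof. by rewrite -pval_radical; apply: quot_map_eq0. Qed.

(** A nonzero class of e y in L/JL spans a copy of Re/Je, which the semisimple
    L/JL projects onto. *)
Lemma map_to_top (L : lmodType R) (y : L) : e *: y \notin @ideal_mul R J L ->
  exists h : {linear L -> simple_top}, h (e *: y) = top_map pgen.
Proof.
move=> nJy; have clJL := ideal_mul_closed spJ L.
have JeP (a : R) : a *: (e *: y) \in @ideal_mul R J L -> a * e \in J.
  move=> Ja; apply: contraT => nJae; case/negP: nJy.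
  pose I : {pred R^o} := fun b : R => b *: (e *: y) \in @ideal_mul R J L.
  suff : (1 : R^o) \in I by rewrite unfold_in /I scale1r.
  apply: local_idempotent_test; [exact: transporter_closed | | by exists a].
  by move=> b Jb; rewrite unfold_in /I scalerA; apply: mem_ideal_mul.
pose G : {pred L * simple_top} := pred_of_Prop (fun z => exists a : R,
  z.1 - a *: (e *: y) \in @ideal_mul R J L /\ z.2 = top_map (a *: pgen)).
have [||h hG] := @semisimple_extend _ _ spJ L simple_top G.
- split; first split.
  + apply/in_PropP; exists 0; rewrite /= !scale0r !linear0 addr0.
    by split=> //; apply: (submod0 clJL).
  + move=> c [u1 u2] [v1 v2] /in_PropP[a /= [Ja ->]] /in_PropP[b /= [Jb ->]].
    apply/in_PropP; exists (c * a + b) => /=; split; last first.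
      by rewrite scalerDl -scalerA linearP.
    rewrite scalerDl -[(c * a) *: _]scalerA opprD addrACA -scalerBr.
    exact: clJL.2.
  + move=> s /in_PropP[a /= [Ja ->]]; apply/top_map_eq0; rewrite pvalZ pgenE.
    apply: JeP; rewrite -[_ *: _](subKr 0).
    by apply: (submodB clJL) => //; apply: (submod0 clJL).
- move=> a b Ja; apply/in_PropP; exists 0.
  by rewrite /= !scale0r !linear0 addr0; split=> //; apply: mem_ideal_mul.
exists h; apply: hG; apply/in_PropP; exists 1; rewrite /= !scale1r subrr.
by split=> //; apply: (submod0 clJL).
Qed.

End LocalProjective.

(** * The right simple module eR/eJ *)

Section ConverseConverse.
Variable R : pzRingType.

(** R is its own double converse. *)
Definition to_converse2 (x : R) : ((R^c)^c)%type := x.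

Fact to_converse2_additive : zmod_morphism to_converse2.
Proof. by []. Qed.
Fact to_converse2_multiplicative : monoid_morphism to_converse2.
Proof. by []. Qed.
HB.instance Definition _ :=
  GRing.isZmodMorphism.Build R ((R^c)^c)%type to_converse2 to_converse2_additive.
HB.instance Definition _ :=
  GRing.isMonoidMorphism.Build R ((R^c)^c)%type to_converse2 to_converse2_multiplicative.

End ConverseConverse.

Section RightTop.
Variables (R : pzRingType) (spJ : semiprimary_ideal (jacobson R)) (e : R).
Hypothesis le : local_idempotent e.
Local Notation J := (jacobson R).
Let clJ := sp_left spJ.
Let ee : e * e = e := le.1.

Definition rdual (M : lmodType R) : lmodType R^c :=
  dual (idfun : {rmorphism R^c -> R^c}) M.

Definition rdual_map (M N : lmodType R) (f : {linear M -> N}) :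
    {linear rdual N -> rdual M} :=
  @dual_map R (R^c)%type idfun M N f.

Definition rdual_chain (c : proj_chain R) : inj_chain (R^c)%type :=
  @dual_chain R (R^c)%type idfun (@to_converse2 R) (fun=> erefl) (fun=> erefl) c.

(** The sum of the simple left modules, with multiplicities. Its dual contains
    every simple right module, by [rdual_residue_detects]. *)
Definition residue_module : lmodType R := quotient_module (jacobson_closed R).

Lemma rdual_residue_killed a (d : rdual residue_module) : a \in J ->
  (a : R^c) *: d = 0.
Proof.
move=> Ja; apply: dual_ext => z; rewrite dual_funZ.
have [x <-] := quot_map_surj z; rewrite -linearZ.
have -> : quot_map (jacobson_closed R) ((idfun (a : R^c) : R) *: x) = 0.
  by apply/quot_map_eq0; apply: jacobson_mulr.
exact: dual_fun0r.
Qed.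

Lemma rdual_residue_detects (X : lmodType R^c) (y : X) :
    y \notin @ideal_mul (R^c)%type J X ->
  exists f : {linear X -> rdual residue_module}, f y <> 0.
Proof.
move=> nJy; have spJc := semiprimary_converse spJ.
have clJX := ideal_mul_closed spJc X.
have [|u [uD uJ uy]] := @QZ_separates X (@ideal_mul (R^c)%type J X) y _ nJy.
  by split; [exact: (submod0 clJX) | exact: (submodB clJX)].
have uB v w : v - w \in @ideal_mul (R^c)%type J X -> u v = u w.
  by move=> Jvw; rewrite -(subrK w v) uD uJ ?add0r.
have uZ (a b : R) (w : X) : a - b \in J -> u ((a : R^c) *: w) = u ((b : R^c) *: w).
  by move=> Jab; apply: uB; rewrite -scalerBl; apply: mem_ideal_mul.
have [s sK] := choice (@quot_map_surj _ _ _ (jacobson_closed R)).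
have sJ (z : residue_module) (a : R) : quot_map (jacobson_closed R) a = z -> s z - a \in J.
  by move=> az; apply/(quot_map_eq0 (jacobson_closed R)); rewrite linearB sK az subrr.
have fD w : {morph (fun z : residue_module => u ((s z : R^c) *: w)) : z z' / z + z'}.
  move=> z z' /=; rewrite -uD -scalerDl; apply: uZ; apply: sJ.
  by rewrite linearD !sK.
have [f fE] : exists f : {linear X -> rdual residue_module},
    forall w, f w = dual_of (idfun : {rmorphism R^c -> R^c}) (fD w).
  apply: linear_exists => a v w; apply: dual_ext => z.
  rewrite dual_funDl dual_funZ !dual_ofE scalerDr uD scalerA; congr (_ + _).
  apply/esym/(uZ _ ((a : R) * s z)); apply: sJ.
  by rewrite -[(a : R) * _]/((a : R) *: (s z : R^o)) linearZ sK.
exists f => fy0; apply: uy.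
have : dual_fun (f y) (quot_map (jacobson_closed R) (1 : R)) = 0 by rewrite fy0.
rewrite fE dual_ofE => <-; rewrite -[y in LHS]scale1r; apply: (uZ 1).
by rewrite -(opprB (s _)) -sub0r jacobsonB ?(submod0 clJ) ?sJ.
Qed.

Lemma right_annihilator_closed :
  submod_closed (fun a : (R^c)^o => e * (a : R) \in J : bool).
Proof.
split=> [|a u v Ju Jv].
  by rewrite unfold_in mulr0 (submod0 (jacobson_closed R)).
rewrite unfold_in -[a *: u + v]/((u : R) * (a : R) + v) mulrDr mulrA.
by apply: jacobsonD => //; apply: jacobson_mulr.
Qed.

(** The simple right module eR/eJ, presented as the quotient of the regular
    right module by the annihilator of the class of e, so that maps out of it
    are the elements killed by that annihilator. *)
Definition right_top : lmodType R^c := quotient_module right_annihilator_closed.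

Definition rgen : right_top := quot_map right_annihilator_closed (1 : R).

Lemma right_topP (z : right_top) : exists a : R, z = (a : R^c) *: rgen.
Proof.
have [a <-] := quot_map_surj z; exists a; rewrite /rgen -linearZ.
by congr (quot_map _ _); rewrite -[RHS]/(1 * (a : R)) mul1r.
Qed.

Lemma rgen_eq0 (a : R) : e * a \in J -> (a : R^c) *: rgen = 0.
Proof.
move=> Jea; rewrite /rgen -linearZ; apply/quot_map_eq0.
by rewrite unfold_in -[_ *: _]/(1 * a) mul1r.
Qed.

Lemma right_top_fg : finitely_generated right_top.
Proof.
exists 1%N, (fun=> rgen) => z; have [a ->] := right_topP z.
by exists (fun=> a); rewrite big_ord1.
Qed.

Lemma right_top_killed (b : R) (z : right_top) : b \in J -> (b : R^c) *: z = 0.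
Proof.
move=> Jb; have [a ->] := right_topP z.
rewrite scalerA -[(b : R^c) * a]/(a * b : R); apply: rgen_eq0.
by rewrite mulrA; apply: jacobson_mull.
Qed.

Lemma right_top_hom (X : lmodType R^c) (y : X) :
    (forall a : R, e * a \in J -> (a : R^c) *: y = 0) ->
  exists f : {linear right_top -> X}, f rgen = y.
Proof.
move=> yJ; have [h hE] : exists h : {linear (R^c)^o -> X},
    forall a : R, h a = (a : R^c) *: y.
  by apply: linear_exists => a u v; rewrite scalerDl scalerA.
have [|f fE] := @factor_surj _ _ _ _ (quot_map right_annihilator_closed) h
  (@quot_map_surj _ _ _ _).
  by move=> a /quot_map_eq0 Jea; rewrite hE; apply: yJ.
by exists f; rewrite /rgen fE hE scale1r.
Qed.

(** A map T -> Hom_Z(M, Q/Z) is a biadditive map on T x M balanced over R, and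
    T J = 0. *)
Lemma right_top_dual_killed (M : lmodType R) (f : {linear right_top -> rdual M})
  (z : right_top) (w : M) : w \in @ideal_mul R J M -> dual_fun (f z) w = 0.
Proof.
move=> Jw; pose N := pred_of_Prop (fun w : M => forall z, dual_fun (f z) w = 0).
suff /in_PropP/(_ z) : w \in N by [].
apply: (ideal_mul_sub _ _ Jw).
  split; first by apply/in_PropP => z'; apply: dual_fun0r.
  move=> a u v /in_PropP Nu /in_PropP Nv; apply/in_PropP => z'.
  rewrite dual_funDr Nv addr0.
  have := dual_funZ (a : R^c) (f z') u; rewrite -linearZ /= => <-.
  exact: Nu.
move=> a x Ja; apply/in_PropP => z'.
have := dual_funZ (a : R^c) (f z') x; rewrite -linearZ /= => <-.
by rewrite right_top_killed // linear0.
Qed.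

(** Put k = m + 1 and resolve the left module R/J. As S has injective
    dimension at most m, every map from the k-th syzygy L to S extends to Q,
    so it kills the defect of L; hence e maps the defect into JL. Dually,
    every map from T to Hom_Z(L, Q/Z) lifts to Hom_Z(Q, Q/Z), which says that
    Ext^k(T, Hom_Z(R/J, Q/Z)) = 0, so every map from the k-th syzygy of T to
    the dual of R/J extends. Such maps detect right modules modulo J, so the
    defect on the right side is small and the m-th syzygy of T is projective.
    *)
Lemma dual_top_finite_proj_dim m :
  has_inj_resolution (simple_top e) m -> has_proj_resolution right_top m.
Proof.
move=> /inj_chain_of_resolution[d dS injd].
have [c c0] := proj_chain_exists residue_module.
set L := syzygy c m.+1; set Q := pc_proj c m.
pose i : {linear L -> Q} := pc_incl c m.
have [r rE] := approximate_retraction spJ i (@pc_projective _ c m).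
have ext : extendable i (simple_top e).
  by rewrite -dS; apply: extend_syzygy injd.
have defect l : e *: (l - r (i l)) \in @ideal_mul R J L.
  apply: contraT => nJ; have [h hE] := map_to_top spJ le nJ.
  have [g gE] := ext h.
  have : h (e *: (l - r (i l))) = 0.
    rewrite -gE; apply: (ideal_mul_killed (J := J) g) => [a s|]; first exact: top_killed.
    by rewrite linearZ; apply: (submodZ (ideal_mul_closed spJ Q)).
  rewrite hE => /(top_map_eq0 spJ le); rewrite pgenE.
  by rewrite (negPf (local_idempotent_notin le)).
have [c' c'0] := proj_chain_exists right_top.
have lift : liftable right_top (ic_quot (rdual_chain c) m).
  move=> f; exists (rdual_map r \o f) => z.
  apply: dual_ext => x.
  have -> : dual_fun (ic_quot (rdual_chain c) m ((rdual_map r \o f) z)) x =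
    dual_fun (f z) (r (i x)) by [].
  apply/eqP; rewrite eq_sym -subr_eq0; apply/eqP.
  have fB (w w' : L) : dual_fun (f z) (w - w') = dual_fun (f z) w - dual_fun (f z) w'.
    by apply/eqP; rewrite eq_sym subr_eq -dual_funDr subrK.
  rewrite -fB; have [a ->] := right_topP z.
  rewrite linearZ dual_funZ /=.
  set y := (a : R) *: (x - r (i x)).
  have yE : y = a *: x - r (i (a *: x)) by rewrite /y scalerBr !linearZ.
  have -> : y = e *: y + (1 - e) *: y by rewrite scalerBl scale1r addrC subrK.
  rewrite dual_funDr right_top_dual_killed ?yE ?defect // add0r.
  rewrite -(dual_funZ ((1 - e : R) : R^c)) -linearZ /= rgen_eq0 ?linear0 //.
  by rewrite mulrBr mulr1 ee subrr (submod0 clJ).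
have ext' : extendable (pc_incl c' m) (cosyzygy (rdual_chain c) 0).
  by apply/staircase; rewrite addn0 c'0.
have spJc := semiprimary_converse spJ.
have [r' r'E] := approximate_retraction spJc (pc_incl c' m) (@pc_projective _ c' m).
rewrite -c'0; apply: proj_resolution_of_chain.
apply: (split_of_small_defect spJc (pc_exact c' m) (@pc_projective _ c' m) (r := r')).
move=> l; apply: contraT => nJ.
have [f fn0] := rdual_residue_detects nJ.
have [g gE] : exists g : {linear pc_proj c' m -> rdual residue_module},
    forall x, g (pc_incl c' m x) = f x.
  by move: ext'; rewrite /= c0 => /(_ f).
case: fn0; rewrite -gE; apply: (@ideal_mul_killed (R^c)%type J _ _ g _ _ (r'E l)) => a x Ja.
exact: rdual_residue_killed.
Qed.

(** The hypotheses say that Tor_(n+1)(T, M) is nonzero for the module M that c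
    resolves. If T had projective dimension at most n, each map from T to the
    dual of the syzygy L would lift to the dual of Q; but a character of L
    that detects e x, seen as such a map, cannot extend to Q because x lies in
    JQ, which T kills. *)
Lemma proj_dim_lower_bound (c : proj_chain R) n p
    (r : {linear pc_proj c n -> syzygy c n.+1}) (l : syzygy c n.+1) :
    pc_incl c n (l - r (pc_incl c n l)) \in @ideal_mul R J (pc_proj c n) ->
    e *: (l - r (pc_incl c n l)) \notin @ideal_mul R J (syzygy c n.+1) ->
  has_proj_resolution right_top p -> (n < p)%N.
Proof.
set x := l - _ => JQx nJx resT; rewrite ltnNge; apply/negP => le_pn.
have [c' c'0 projc'] := proj_chain_of_resolution resT.
have lift : liftable right_top (ic_quot (rdual_chain c) n).
  by rewrite -c'0; apply: lift_to_coresolution; apply: projc'.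
set L := syzygy c n.+1 in x nJx JQx; have clJL := ideal_mul_closed spJ L.
(* A character vanishing on A vanishes on a L whenever e a is in J, which is
   what a map defined on T requires of the image of the generator. *)
pose A : {pred L} := fun y => e *: y \in @ideal_mul R J L.
have [|phi [phiD phiA phix]] := @QZ_separates L A x _ nJx.
  split=> [|u v Au Av]; rewrite unfold_in /A ?scaler0 ?(submod0 clJL) //.
  by rewrite scalerBr; apply: (submodB clJL).
pose y : rdual L := dual_of (idfun : {rmorphism R^c -> R^c}) phiD.
have [|f fE] := @right_top_hom (rdual L) y.
  move=> a Jea; apply: dual_ext => w; rewrite dual_funZ dual_ofE phiA //.
  by rewrite unfold_in /A scalerA; apply: mem_ideal_mul.
have [g gE] := lift f; apply: phix.
have -> : phi x = dual_fun (f rgen) x by rewrite fE dual_ofE.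
rewrite -gE -[LHS]/(dual_fun (g rgen) (pc_incl c n x)).
exact: right_top_dual_killed.
Qed.

End RightTop.

(** * The bound on projective dimensions *)

Section Extended.

Lemma enat_leastP (P : nat -> Prop) n :
  enat_least P = Some n <-> P n /\ forall m, P m -> (n <= m)%N.
Proof.
rewrite /enat_least; case: pselect => [exP | noP]; last first.
  by split=> // -[Pn _]; case: noP; exists n; apply/asboolP.
case: ex_minnP => m /asboolP Pm minm; split=> [[<-] | [Pn minn]].
  by split=> // k Pk; apply: minm; apply/asboolP.
by congr Some; apply/eqP; rewrite eqn_leq minn ?minm //; apply/asboolP.
Qed.

Lemma enat_least_None (P : nat -> Prop) :
  enat_least P = None <-> forall n, ~ P n.
Proof.
rewrite /enat_least; case: pselect => [exP | noP]; split=> //.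
  by move=> noP; have [n /asboolP/noP] := exP.
by move=> _ n Pn; case: noP; exists n; apply/asboolP.
Qed.

Lemma enat_least_bound (P : nat -> Prop) n : P n ->
  exists2 m, enat_least P = Some m & (m <= n)%N.
Proof.
move=> Pn; case E : (enat_least P) => [m|].
  by exists m => //; have [_] := (enat_leastP P m).1 E; apply.
by have := (enat_least_None P).1 E n.
Qed.

End Extended.

Section Loewy.
Variable R : pzRingType.
Local Notation J := (jacobson R).

(** The powers are built by multiplying on the left by J; here J multiplies on
    the right. *)
Lemma jacobson_exp_mulr t (a b : R) :
  a \in @jacobson_exp R t -> b \in J -> a * b \in @jacobson_exp R t.+1.
Proof.
elim: t a => [|t IH] a; rewrite /jacobson_exp !iterS.
  move=> _ Jb; apply/asboolP; exists 1%N, (fun=> a * b), (fun=> 1).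
  split=> // [_|]; first exact: jacobson_mull.
  by rewrite big_ord1 -[RHS]/(a * b * 1) mulr1.
move=> /asboolP[n [c [x [Jc Jx ->]]]] Jb; apply/asboolP.
exists n, c, (fun i => (x i : R) * b); split=> // [i|]; first exact: IH.
by rewrite mulr_suml; apply: eq_bigr => i _; rewrite -[LHS]mulrA.
Qed.

Lemma loewy_length_semiprimary : semiprimary R ->
  exists n, loewy_length R^o = Some n /\ forall x, x \in @jacobson_exp R n -> x = 0.
Proof.
move=> [_ [t Jt]]; have [|n nE _] := @enat_least_bound (fun t =>
  forall x, x \in @ideal_smul R R^o (@jacobson_exp R t) predT -> x = 0) t.
  move=> x /asboolP[m [a [y [Ja _ ->]]]]; rewrite big1 // => i _.
  by rewrite (Jt _ (Ja i)) scale0r.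
exists n; split=> // x Jx; have [Pn _] := (enat_leastP _ _).1 nE; apply: Pn.
apply/asboolP; exists 1%N, (fun=> x), (fun=> 1); split=> //.
by rewrite big_ord1 -[RHS]/(x * 1) mulr1.
Qed.

Lemma loewy_length_bound (M : lmodType R) n :
    (forall a (x : M), a \in @jacobson_exp R n -> a *: x = 0) ->
  exists2 m, loewy_length M = Some m & (m <= n)%N.
Proof.
move=> Jn0; apply: enat_least_bound => x /asboolP[m [a [y [Ja _ ->]]]].
by rewrite big1 // => i _; apply: Jn0.
Qed.

End Loewy.

Section Main.
Variable R : pzRingType.
Hypotheses (spR : semiprimary R) (quR : quasi_uniform_loewy_length R).
Local Notation J := (jacobson R).
Let spJ : semiprimary_ideal J := semiprimary_jacobson spR.

(** The projective L maps onto Re, with the element e d x going to a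
    generator; since i embeds the image of d into JQ, that element is killed
    by J^(n-1) for n the Loewy length of R, hence so is Re. *)
Lemma non_maximal_principal (e : R) (le : local_idempotent e) (L Q : lmodType R)
    (i : {linear L -> Q}) (d : {linear L -> L}) (x : L) :
    projective L -> injective i -> (forall l, i (d l) \in @ideal_mul R J Q) ->
    e *: d x \notin @ideal_mul R J L ->
  ~ maximal_loewy_length (principal e).
Proof.
move=> projL inj_i Jid nJ.
have [h hE] := map_to_top spJ le nJ.
have [th thE] := projL _ _ (top_map e) h (@quot_map_surj _ _ _ _).
have [|a aE] := @principal_generator _ spJ _ le (th (e *: d x)).
  apply/negP => /(top_map_eq0 spJ le); rewrite thE hE => /(top_map_eq0 spJ le).
  by rewrite pgenE (negPf (local_idempotent_notin le)).
have [n [nE Jn0]] := loewy_length_semiprimary spR.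
case: n nE Jn0 => [|n] nE Jn0.
  (* Loewy length 0: the ring is zero. *)
  case/negP: nJ.
  have -> : e *: d x = 0 by rewrite -[LHS]scale1r (Jn0 1 isT) scale0r.
  exact: (submod0 (ideal_mul_closed spJ L)).
have [|m mE lemn] := @loewy_length_bound R (principal e) n.
  move=> b y Jb; have -> : b *: y = th (b *: (pval y *: (a *: (e *: d x)))).
    by rewrite !linearZ /=; rewrite linearZ /= in aE; rewrite aE -(principal_gen le y).
  suff -> : b *: (pval y *: (a *: (e *: d x))) = 0 by rewrite linear0.
  rewrite !scalerA -!mulrA; set w := pval y * _.
  have -> : (b * w) *: d x = b *: d (w *: x) by rewrite linearZ /= scalerA.
  apply: inj_i; rewrite linear0 [LHS]linearZ /=.
  have /ideal_mulP[k [c [q [Jc ->]]]] := Jid (w *: x).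
  rewrite scaler_sumr big1 // => j _.
  by rewrite scalerA (Jn0 _ (jacobson_exp_mulr Jb (Jc j))) scale0r.
by rewrite /maximal_loewy_length mE nE => -[mn]; rewrite mn ltnn in lemn.
Qed.

(** The n-th syzygy K of M is not projective, so the defect of its cover is
    not small: some e_j moves a defect element outside JL. Then R e_j is not
    of maximal Loewy length, quasi-uniformity makes the injective dimension of
    its top finite, hence also the projective dimension of e_j R/e_j J, which
    exceeds n. *)
Lemma proj_dim_bounded_by_right_top (m : nat) (e a : 'I_m -> R) (M : lmodType R) n :
    (forall j, local_idempotent (e j)) -> 1 - \sum_j a j * e j \in J ->
    proj_dim M = Some n.+1 ->
  exists j p, proj_dim (right_top (e j)) = Some p /\ (n < p)%N.
Proof.
move=> le span /enat_leastP[resM minM].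
have [c cM projc] := proj_chain_of_resolution resM.
have projL := projc n.+1 (leqnn _).
have [r rE] := approximate_retraction spJ (pc_incl c n) (@pc_projective _ c n).
have [l nJl] : exists l, l - r (pc_incl c n l) \notin @ideal_mul R J (syzygy c n.+1).
  apply: contrapT => noL.
  suff /minM : has_proj_resolution M n by rewrite ltnn.
  rewrite -cM; apply: proj_resolution_of_chain.
  apply: (split_of_small_defect spJ (pc_exact c n) (@pc_projective _ c n) (r := r)).
  by move=> l; apply: contraT => nJl; case: noL; exists l.
have [d dE] : exists d : {linear syzygy c n.+1 -> syzygy c n.+1},
    forall l, d l = l - r (pc_incl c n l).
  by apply: linear_exists => b x y; rewrite !linearP scalerDr addrACA.
have clJL := ideal_mul_closed spJ (syzygy c n.+1).
have [j nJj] : exists j, e j *: d l \notin @ideal_mul R J (syzygy c n.+1).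
  apply: contrapT => noj; case/negP: nJl; rewrite -dE.
  rewrite -[d l]scale1r -(subrK (\sum_j a j * e j) 1) scalerDl.
  apply: (submodD clJL); first exact: mem_ideal_mul.
  rewrite scaler_suml; apply: (submod_sum clJL) => j; rewrite -scalerA.
  apply: (submodZ clJL); apply: contraT => nJj; case: noj; by exists j.
have nmax : ~ maximal_loewy_length (principal (e j)).
  have [inj_i _ _] := pc_exact c n.
  by apply: (non_maximal_principal (le j) projL inj_i _ nJj) => y; rewrite dE.
have [q qE] : exists q, inj_dim (top (principal (e j))) = Some q.
  case E : (inj_dim _) => [q|]; first by exists q.
  by case: nmax; apply: quR => //;
    [exact: (principal_projective (le j)) | exact: (principal_indecomposable spJ (le j))].
have /enat_leastP[resS _] := qE.
have resT := dual_top_finite_proj_dim spJ (le j) resS.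
have [p pE _] := enat_least_bound resT.
exists j, p; split=> //; have /enat_leastP[resT' _] := pE.
by apply: (proj_dim_lower_bound spJ (rE l) _ resT'); rewrite -dE.
Qed.

End Main.

Theorem theoremB (R : pzRingType) :
  semiprimary R -> quasi_uniform_loewy_length R ->
  Findim R <> None /\
  (artin_algebra R -> enat_le (Findim R) (findim (R^c)%type)).
Proof.
move=> spR quR; pose spJ := semiprimary_jacobson spR.
have [m [e [a [le span]]]] := local_idempotents_span spJ.
pose T j := right_top (e j).
have bound (M : lmodType R) n : proj_dim M = Some n.+1 ->
    exists j p, proj_dim (T j) = Some p /\ (n < p)%N.
  exact: (proj_dim_bounded_by_right_top spR quR le span).
have Findim_le q : (forall j p, proj_dim (T j) = Some p -> (p <= q)%N) ->
    exists2 d, Findim R = Some d & (d <= q)%N.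
  move=> Tq; apply: enat_least_bound => _ [M [fin ->]].
  case E : (proj_dim M) fin => [[|n]|] //= _.
  by have [j [p [pE ltnp]]] := bound M n E; apply: leq_trans ltnp (Tq j p pE).
split=> [|_].
  pose pd j := odflt 0%N (proj_dim (T j)).
  have [|d -> //] := Findim_le (\max_j pd j).
  by move=> j p pE; have := leq_bigmax (F := pd) j; rewrite /pd pE.
case E : (findim _) => [q|]; last by case: (Findim R).
have [Tq _] := (enat_leastP _ q).1 E.
have [|d -> //] := Findim_le q.
move=> j p pE; apply: (Tq (Some p)); exists (T j); rewrite pE; split=> //.
exact: right_top_fg.
Qed.
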